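(* Let $D$ be a division ring with infinite center $F$, let $n\ge 1$, and let $G$ be an almost subnormal subgroup of $\mathrm{GL}_n(D)$. If $G$ satisfies a generalized group identity over $\mathrm{GL}_n(D)$, then $G$ is central, i.e. $G$ is contained in the center of $\mathrm{GL}_n(D)$.
   Context: A subgroup $H$ of a group $K$ is almost subnormal in $K$ if there is a chain of subgroups $H=H_r\le H_{r-1}\le\cdots\le H_1=K$ such that for each $1<i\le r$, either $H_i$ is normal in $H_{i-1}$ or $H_i$ has finite index in $H_{i-1}$. For a group $K$, a generalized group monomial over $K$ is an expression $w(x_1,\dots,x_m)=a_1x_{i_1}^{\alpha_1}a_2x_{i_2}^{\alpha_2}\cdots a_tx_{i_t}^{\alpha_t}a_{t+1}$ with $t,m\ge 1$, $i_j\in\{1,\dots,m\}$, $a_j\in K$, $\alpha_j\in\mathbb{Z}\setminus\{0\}$, such that whenever $i_j=i_{j+1}$ and $\alpha_j\alpha_{j+1}<0$, the coefficient standing between $x_{i_j}^{\alpha_j}$ and $x_{i_{j+1}}^{\alpha_{j+1}}$ is not in the center $Z(K)$. A subgroup $H\le K$ satisfies the generalized group identity $w=1$ over $K$ if $w(c_1,\dots,c_m)=1$ for all $c_1,\dots,c_m\in H$. *)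

(* Defs.v *)
From mathcomp Require Import all_boot all_algebra.
Set Implicit Arguments. Unset Strict Implicit. Unset Printing Implicit Defensive.
Import GRing.Theory.
Local Open Scope ring_scope.

Definition is_division_ring (R : unitRingType) : Prop :=
  forall x : R, x != 0 -> x \is a GRing.unit.

Definition ring_center (R : pzRingType) (x : R) : Prop := forall y : R, x * y = y * x.

Definition infinite_set (T : eqType) (S : T -> Prop) : Prop :=
  forall s : seq T, exists x, S x /\ x \notin s.

Section GLDefs.
Variables (D : unitRingType) (n : nat).
Local Notation M := 'M[D]_n.

Definition inGL (A : M) : Prop := exists B : M, A * B = 1 /\ B * A = 1.

Definition central_GL (A : M) : Prop :=
  inGL A /\ forall B : M, inGL B -> A * B = B * A.

Definition is_subgroup (G : M -> Prop) : Prop :=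
  [/\ forall A, G A -> inGL A,
      G 1,
      forall A B, G A -> G B -> G (A * B)
    & forall A B, G A -> A * B = 1 -> B * A = 1 -> G B].

Definition subset_of (H K : M -> Prop) : Prop := forall A, H A -> K A.

Definition normal_in (H K : M -> Prop) : Prop :=
  forall x y h, K x -> x * y = 1 -> y * x = 1 -> H h -> H (x * h * y).

Definition finite_index_in (H K : M -> Prop) : Prop :=
  exists s : seq M, forall x, K x -> exists2 g, g \in s & exists h, H h /\ x = g * h.

Definition almost_subnormal (H K : M -> Prop) : Prop :=
  exists (r : nat) (chain : nat -> (M -> Prop)),
    [/\ chain 0%N = K, chain r = H,
        forall i, (i <= r)%N -> is_subgroup (chain i)
      & forall i, (i < r)%N ->
          subset_of (chain i.+1) (chain i) /\
          (normal_in (chain i.+1) (chain i) \/ finite_index_in (chain i.+1) (chain i))].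

(* Generalized group monomials over GL_n(D):
   w = a_1 x_{i_1}^{al_1} a_2 ... a_t x_{i_t}^{al_t} a_{t+1},
   encoded as the head coefficient a_1 and the list [(i_j, al_j, a_{j+1})]_{j=1..t}. *)
Record ggmonomial := GGMonomial { gm_head : M ; gm_tail : seq (nat * int * M) }.

Definition is_gen_monomial (w : ggmonomial) : Prop :=
  let s := gm_tail w in
  [/\ s != [::],
      inGL (gm_head w),
      forall e, e \in s -> e.1.2 != 0 /\ inGL e.2
    & forall j, (j.+1 < size s)%N ->
        let e := nth (0%N, 0, 1) s j in
        let e' := nth (0%N, 0, 1) s j.+1 in
        e.1.1 = e'.1.1 -> e.1.2 * e'.1.2 < 0 -> ~ central_GL e.2].

Definition gpow (x xi : M) (al : int) : M :=
  match al with Posz k => x ^+ k | Negz k => xi ^+ k.+1 end.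

Fixpoint eval_tail (c ci : nat -> M) (s : seq (nat * int * M)) : M :=
  match s with
  | [::] => 1
  | (i, al, a) :: s' => gpow (c i) (ci i) al * a * eval_tail c ci s'
  end.

Definition gm_eval (w : ggmonomial) (c ci : nat -> M) : M :=
  gm_head w * eval_tail c ci (gm_tail w).

Definition satisfies_ggi (H : M -> Prop) (w : ggmonomial) : Prop :=
  forall c ci : nat -> M,
    (forall i, H (c i) /\ c i * ci i = 1 /\ ci i * c i = 1) -> gm_eval w c ci = 1.

End GLDefs.

(* Main.v *)
From HB Require Import structures.
Require Import Defs.
From mathcomp Require Import all_boot all_algebra.
From Stdlib Require Import Classical.
Import GRing.Theory.
Local Open Scope ring_scope.

(** A noncentral element of [G] lets one pull a generalized identity up the
    almost subnormal chain (through [x^N] at a finite index step, and through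
    products of two conjugates of that element at a normal step), so it suffices
    to refute one for [GL_n(D)].  Conjugating each variable by a suitable
    constant reduces it to one variable [x], occurring with exponents [1] and
    [-1] only, with all inner coefficients noncentral.  Put [x = 1 + t y] with
    [t] central.  If [y^2 = 0], a word with [r] letters is a polynomial in [t]
    with leading term [+- a_1 y a_2 y ... y a_(r+1) t^r], which should be made
    nonzero.

    For [n >= 2] take [y = v phi] of rank one with [phi v = 0] and
    [phi a v <> 0] for the finitely many inner coefficients [a].

    For [n = 1], clearing denominators in [D[X]] (an Ore domain) shows that the
    nonconstant coefficients of the expansion in [t] vanish for every [y] in [D], hence,
    the center being infinite, for every [y] in [D[X]].  Let [X] act on [D] by
    right multiplication by some [b] not commuting with the inner coefficients.
    By Jacobson density over the centralizer [C] of [b], some [y] in [D[X]]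
    kills [1], maps the finitely many relevant vectors to [C], and maps the inner
    coefficients to nonzero elements of [C]; then [y] squares to zero on all
    vectors involved, and the coefficient of top degree does not vanish. *)

Set Implicit Arguments. Unset Strict Implicit. Unset Printing Implicit Defensive.

(** * Polynomials over a division ring *)

Section DivisionRing.
Variable D : unitRingType.
Hypothesis divD : is_division_ring D.

Lemma div_mulf_neq0 (x y : D) : x != 0 -> y != 0 -> x * y != 0.
Proof.
move=> /divD ux y0; apply: contra y0 => /eqP xy0.
by rewrite -[y](mulKr ux) xy0 mulr0.
Qed.

Lemma div_poly_mulf_neq0 (p q : {poly D}) : p != 0 -> q != 0 -> p * q != 0.
Proof.
move=> p0 q0; rewrite -lead_coef_eq0 lead_coef_proper_mul;
  by apply: div_mulf_neq0; rewrite lead_coef_eq0.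
Qed.

(** Noncentral roots can be infinitely many. At a central point evaluation respects the
    factorization, so each central root splits off a linear factor and lowers the degree. *)
Lemma central_roots_finite (P : {poly D}) : P != 0 ->
  exists s : seq D, forall mu, ring_center mu -> P.[mu] = 0 -> mu \in s.
Proof.
move: {2}(size P) (leqnn (size P)) => n; elim: n P => [|n IHn] P.
  by rewrite size_poly_leq0 => ->.
move=> sP P0.
have [[mu [cmu Pmu]]|noroot] := classic (exists mu, ring_center mu /\ P.[mu] = 0);
  last by exists [::] => mu cmu Pmu; case: noroot; exists mu.
have /factor_theorem[Q PQ] : root P mu by apply/eqP.
have Q0 : Q != 0 by apply: contraNneq P0 => Q0; rewrite PQ Q0 mul0r.
have [|s sP'] := IHn Q _ Q0.
  by move: sP; rewrite PQ size_Mmonic ?monicXsubC // size_XsubC addn2.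
exists (mu :: s) => nu cnu; rewrite PQ hornerM_comm => [|]; last first.
  by rewrite /comm_poly cnu.
rewrite hornerXsubC in_cons => Qnu.
have [//|neq] := eqVneq nu mu; apply: sP' => //.
by apply/eqP/negPn/negP => /div_mulf_neq0 /(_ (_ : nu - mu != 0)); rewrite subr_eq0 Qnu eqxx => /(_ neq).
Qed.

Hypothesis infF : infinite_set (@ring_center D).

Lemma central_nonroot (P : {poly D}) (s : seq D) : P != 0 ->
  exists mu, [/\ ring_center mu, mu \notin s & P.[mu] != 0].
Proof.
move=> /central_roots_finite[s' sP]; have [mu [cmu]] := infF (s ++ s').
rewrite mem_cat negb_or => /andP[mus mus']; exists mu; split=> //.
by apply: contra mus' => /eqP /(sP _ cmu).
Qed.

Lemma poly_eq0_of_central_values (s : seq D) (P : {poly D}) :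
  (forall mu, ring_center mu -> mu \notin s -> P.[mu] = 0) -> P = 0.
Proof.
move=> P0; apply/eqP/negPn/negP => /(central_nonroot s)[mu [cmu mus]].
by rewrite P0 ?eqxx.
Qed.

(** Conditions that can be met one at a time can be met together. On the line from a point good for
    the earlier conditions to one good for the new condition, each [f i] is a polynomial in [mu],
    nonzero at 0 or at 1. Only finitely many central [mu] are therefore bad. *)
Lemma common_nonvanishing (V : Type) (Phi : V -> Prop) (comb : D -> V -> V -> V)
    (I : eqType) (f : I -> V -> D) (s : seq I) :
  (forall mu p q, ring_center mu -> Phi p -> Phi q -> Phi (comb mu p q)) ->
  (forall i p q, exists P : {poly D}, [/\ P.[0] = f i p, P.[1] = f i q &
      forall mu, ring_center mu -> P.[mu] = f i (comb mu p q)]) ->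
  (exists p, Phi p) ->
  (forall i, i \in s -> exists2 p, Phi p & f i p != 0) ->
  exists2 p, Phi p & forall i, i \in s -> f i p != 0.
Proof.
move=> Phicomb fpoly [p0 Phip0]; elim: s => [|i s IHs] fs; first by exists p0.
have [|p Phip fp] := IHs; first by move=> j js; apply: fs; rewrite in_cons js orbT.
have [|q Phiq fq] := fs i; first by rewrite mem_head.
have [t Ht] : exists t : seq D, forall mu, ring_center mu -> mu \notin t ->
    forall j, j \in i :: s -> f j (comb mu p q) != 0.
  have: forall j, j \in i :: s -> f j p != 0 \/ f j q != 0.
    by move=> j; rewrite in_cons => /predU1P[->|/fp]; [right|left].
  elim: (i :: s) => [|j r IHr] Hr; first by exists [::].
  have [|t Ht] := IHr; first by move=> k kr; apply: Hr; rewrite in_cons kr orbT.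
  have [P [Pp Pq Pcomb]] := fpoly j p q.
  have /central_roots_finite[t' Ht'] : P != 0.
    have := Hr j (mem_head _ _); rewrite -Pp -Pq => H.
    by apply/eqP => P0; case: H; rewrite P0 horner0 eqxx.
  exists (t' ++ t) => mu cmu; rewrite mem_cat negb_or => /andP[mut' mut] k.
  rewrite in_cons => /predU1P[->|]; last exact: Ht.
  by rewrite -Pcomb //; apply: contra mut' => /eqP /(Ht' _ cmu).
have [mu [cmu mut]] := infF t.
by exists (comb mu p q); [exact: Phicomb | exact: Ht].
Qed.

Lemma right_division (p q : {poly D}) : q != 0 ->
  exists u r : {poly D}, p = q * u + r /\ (size r < size q)%N.
Proof.
move=> q0; move: {2}(size p) (leqnn (size p)) => n.
elim: n p => [|n IHn] p sp.
  exists 0, 0; rewrite mulr0 addr0 size_poly0 size_poly_gt0; split=> //.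
  by apply/eqP; rewrite -size_poly_leq0.
have [spq|sqp] := ltnP (size p) (size q).
  by exists 0, p; rewrite mulr0 add0r.
have p0 : p != 0 by rewrite -size_poly_gt0 (leq_trans _ sqp) // size_poly_gt0.
(* The quotient stands to the right of [q], so the inverse leading coefficient goes on the left. *)
pose c := (lead_coef q)^-1 * lead_coef p.
pose m := c *: 'X^(size p - size q).
have [|u [r [Dp sr]]] := IHn (p - q * m); last first.
  by exists (m + u), r; split=> //; rewrite mulrDr -addrA -Dp addrC subrK.
have uq : lead_coef q \is a GRing.unit by rewrite divD // lead_coef_eq0.
have sz : (size (q * m)%R <= size p)%N.
  apply: leq_trans (size_polyMleq _ _) _.
  have := size_scale_leq c 'X^(size p - size q); rewrite size_polyXn -/m => sm.
  rewrite -subn1 leq_subLR; apply: leq_trans (leq_add (leqnn _) sm) _.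
  by rewrite addnS subnKC // add1n.
have cc : (q * m)`_(size p).-1 = lead_coef p.
  rewrite /m -[c *: _]mul_polyC mulrA coefMXn.
  have sq : (0 < size q)%N by rewrite size_poly_gt0.
  have -> : ((size p).-1 < size p - size q)%N = false.
    apply/negbTE; rewrite -leqNgt leq_subLR.
    by rewrite -[X in (X <= _)%N](prednK (leq_trans sq sqp)) -addn1 addnC leq_add.
  have -> : ((size p).-1 - (size p - size q) = (size q).-1)%N.
    by rewrite -subn1 -subn1 subnAC subKn.
  by rewrite coefMC -lead_coefE mulVKr.
rewrite -ltnS; apply: leq_trans sp; rewrite -ltnS.
rewrite -[in X in (_ < X)%N](prednK (_ : 0 < size p)%N) ?size_poly_gt0 //.
rewrite ltnS; apply/leq_sizeP => j; rewrite leq_eqVlt => /predU1P[<-|].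
  by rewrite coefB cc lead_coefE subrr.
rewrite prednK ?size_poly_gt0 // => lj.
by rewrite coefB !nth_default ?subrr // (leq_trans sz).
Qed.

(* Euclid's algorithm: [p R = q S] is obtained from a relation between [q] and
   the remainder of [p] by [q]. *)
Lemma right_ore (p q : {poly D}) : q != 0 ->
  exists R S : {poly D}, R != 0 /\ p * R = q * S.
Proof.
move: {2}(size q) (leqnn (size q)) => n; elim: n p q => [|n IHn] p q.
  by rewrite size_poly_leq0 => ->.
move=> sq q0; have [u [r [Dp sr]]] := right_division p q0.
have [r0|r0] := eqVneq r 0.
  by exists 1, u; rewrite oner_neq0 mulr1 Dp r0 addr0.
have [R [S [R0 RS]]] := IHn q r (leq_trans sr sq) r0.
exists S, (u * S + R); split; last by rewrite Dp mulrDl mulrDr RS mulrA.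
apply: contraTneq (div_poly_mulf_neq0 q0 R0) => S0.
by rewrite RS S0 mulr0 eqxx.
Qed.

End DivisionRing.

(** * Words with coefficients *)

Fixpoint all_prop (T : Type) (P : T -> Prop) (s : seq T) : Prop :=
  if s is x :: s' then P x /\ all_prop P s' else True.

Fixpoint path_prop (T : Type) (J : T -> T -> Prop) (x : T) (s : seq T) : Prop :=
  if s is y :: s' then J x y /\ path_prop J y s' else True.

Lemma all_prop_cat (T : Type) (P : T -> Prop) (s1 s2 : seq T) :
  all_prop P (s1 ++ s2) <-> all_prop P s1 /\ all_prop P s2.
Proof. by elim: s1 => [|x s1 IH] /=; rewrite ?IH; tauto. Qed.

Lemma path_prop_cat (T : Type) (J : T -> T -> Prop) (x : T) (s1 s2 : seq T) :
  path_prop J x (s1 ++ s2) <-> path_prop J x s1 /\ path_prop J (last x s1) s2.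
Proof. by elim: s1 x => [|y s1 IH] x /=; rewrite ?IH; tauto. Qed.

Lemma path_prop_impl (T : Type) (J J' : T -> T -> Prop) (x : T) (s : seq T) :
  (forall y z, J y z -> J' y z) -> path_prop J x s -> path_prop J' x s.
Proof.
by move=> JJ'; elim: s x => [//|y s IH] x /= [/JJ' Jxy /IH].
Qed.

Section Blocks.
Variables (A B : Type) (hd : A -> B) (tl : A -> seq B).

(** Substitution of a block for each letter. Writing a block as head and tail keeps it nonempty, so
    a junction of letters becomes a junction of adjacent blocks. *)
Definition expand (s : seq A) : seq B := flatten [seq hd a :: tl a | a <- s].

Lemma path_prop_expand (J : A -> A -> Prop) (J' : B -> B -> Prop) (a : A) (s : seq A) :
  (forall b, path_prop J' (hd b) (tl b)) ->
  (forall b b', J b b' -> J' (last (hd b) (tl b)) (hd b')) ->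
  path_prop J a s -> path_prop J' (hd a) (tl a ++ expand s).
Proof.
move=> J'in J'out; elim: s a => [|b s IH] a /=.
  by move=> _; rewrite cats0.
by case=> /J'out Jab /IH IHs; apply/path_prop_cat; split.
Qed.

Lemma all_prop_expand (P : A -> Prop) (Q : B -> Prop) (s : seq A) :
  (forall b, P b -> Q (hd b) /\ all_prop Q (tl b)) ->
  all_prop P s -> all_prop Q (expand s).
Proof.
move=> PQ; elim: s => [//|a s IH] /= [/PQ[Qh Qt] /IH Qs].
by split=> //; apply/all_prop_cat.
Qed.

End Blocks.

(* [Letter l i true r] stands for [l * x_i * r] and [Letter l i false r] for
   [l * x_i^-1 * r]. *)
Record letter (R : Type) :=
  Letter { lco : R; lvar : nat; lpos : bool; rco : R }.

Section Words.
Variable R : pzRingType.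
Implicit Types (c ci : nat -> R) (w : seq (letter R)).

Definition leval c ci (e : letter R) : R :=
  lco e * (if lpos e then c (lvar e) else ci (lvar e)) * rco e.

Fixpoint weval c ci w : R := if w is e :: w' then leval c ci e * weval c ci w' else 1.

Lemma weval_cat c ci w1 w2 : weval c ci (w1 ++ w2) = weval c ci w1 * weval c ci w2.
Proof. by elim: w1 => [|e w1 IH] /=; rewrite ?mul1r // IH mulrA. Qed.

Lemma weval_expand (A : Type) (hd : A -> letter R) tl (v : A -> R) c ci s :
  all_prop (fun a => leval c ci (hd a) * weval c ci (tl a) = v a) s ->
  weval c ci (expand hd tl s) = foldr (fun a z => v a * z) 1 s.
Proof.
elim: s => [//|a s IH] [Ea /IH Es].
have -> : expand hd tl (a :: s) = (hd a :: tl a) ++ expand hd tl s by [].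
by rewrite weval_cat /= Ea Es.
Qed.

Lemma weval_foldr c ci w : weval c ci w = foldr (fun e z => leval c ci e * z) 1 w.
Proof. by elim: w => [//|e w IH] /=; rewrite IH. Qed.

(** Together with [power_tl], spells [l * x^(k+1) * r] (or the same with [x^-1]) letter by letter;
    [l] and [r] sit at the two ends. *)
Definition power_hd (l : R) i (b : bool) (r : R) (k : nat) :=
  Letter l i b (if k is 0 then r else 1).
Definition power_tl i (b : bool) (r : R) (k : nat) :=
  if k is k'.+1 then nseq k' (Letter 1 i b 1) ++ [:: Letter 1 i b r] else [::].

Lemma weval_power c ci l i b r k :
  leval c ci (power_hd l i b r k) * weval c ci (power_tl i b r k)
  = l * (if b then c i else ci i) ^+ k.+1 * r.
Proof.
case: k => [|k]; first by rewrite /= /leval /= mulr1 expr1.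
rewrite /= weval_cat /= /leval /= !mulr1 mul1r exprSr exprS !mulrA.
congr (_ * _ * _); rewrite -!mulrA; congr (l * (_ * _)).
by elim: k => [//|k IH] /=; rewrite /leval /= IH mul1r mulr1 exprS.
Qed.

Lemma last_power l i b r k :
  exists l', last (power_hd l i b r k) (power_tl i b r k) = Letter l' i b r.
Proof.
by case: k => [|k]; [exists l | exists 1; rewrite /= last_cat].
Qed.

End Words.

(** * Invertible matrices, noncentrality and conditions on words *)

Section Groups.
Variables (D : unitRingType) (n : nat).
Local Notation M := 'M[D]_n.
Implicit Types (a b u : M) (e : letter M) (w : seq (letter M)).

Definition noncentral a := exists2 u, inGL u & a * u <> u * a.

Definition inverses a b := a * b = 1 /\ b * a = 1.

Lemma inGL1 : inGL (1 : M).
Proof. by exists 1; rewrite mulr1. Qed.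

Lemma inversesM a a' b b' : inverses a a' -> inverses b b' -> inverses (a * b) (b' * a').
Proof.
move=> [aa' a'a] [bb' b'b]; split.
  by rewrite mulrA -(mulrA a) bb' mulr1.
by rewrite mulrA -(mulrA b') a'a mulr1.
Qed.

Lemma inGLM a b : inGL a -> inGL b -> inGL (a * b).
Proof.
by move=> [a' aa'] [b' bb']; exists (b' * a'); apply: (inversesM aa' bb').
Qed.

Lemma inverses_inGL a b : inverses a b -> inGL a /\ inGL b.
Proof. by case=> ab ba; split; [exists b | exists a]. Qed.

Lemma noncentralP a : inGL a -> ~ central_GL a -> noncentral a.
Proof.
move=> Ga nca; apply: NNPP => H; apply: nca; split=> // u Gu.
by apply: NNPP => au; apply: H; exists u.
Qed.

Lemma noncentral_conj a b b' : inverses b b' -> noncentral a -> noncentral (b' * a * b).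
Proof.
move=> bb'; have [Gb Gb'] := inverses_inGL bb'; case: bb' => bb' b'b [u Gu au].
exists (b' * u * b); first by do 2?apply: inGLM.
move=> E; apply: au.
have {E} := congr1 (fun z => b * z * b') E.
have K x y : b * (b' * x * b * (b' * y * b)) * b' = x * y.
  by rewrite !mulrA bb' mul1r -[_ * b * b']mulrA bb' mulr1 -[x * b * b']mulrA bb' mulr1.
by rewrite !K.
Qed.

Lemma noncentral_inverse a b : inverses a b -> noncentral a -> noncentral b.
Proof.
move=> [ab ba] [u Gu au]; exists u => // bu; apply: au.
have := congr1 (fun z => a * z * a) bu.
by rewrite !mulrA ab mul1r -(mulrA _ b) ba mulr1.
Qed.

Definition invertible_letter e := inGL (lco e) /\ inGL (rco e).

(** This is the condition inherited from generalized monomials. The stronger [strict_junction],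
    blind to signs, is what the substitution at a normal step produces. *)
Definition reduced_junction e e' :=
  lvar e = lvar e' -> lpos e <> lpos e' -> noncentral (rco e * lco e').

Definition strict_junction e e' :=
  lvar e = lvar e' -> noncentral (rco e * lco e').

(** Allowing any constant [d] instead of 1 absorbs the head coefficient of a monomial. *)
Definition constant_on (H : M -> Prop) w (d : M) :=
  forall c ci : nat -> M, (forall i, H (c i) /\ inverses (c i) (ci i)) ->
    weval c ci w = d.

Definition has_word (J : letter M -> letter M -> Prop) (H : M -> Prop) :=
  exists e w d, [/\ all_prop invertible_letter (e :: w), path_prop J e w
    & constant_on H (e :: w) d].

End Groups.

(** * Pulling a word up the almost subnormal chain *)

Section Descent.
Variables (D : unitRingType) (n : nat).
Local Notation M := 'M[D]_n.
Local Notation lt := (letter M).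
Local Notation reduced := (@reduced_junction D n).
Local Notation strict := (@strict_junction D n).

Lemma all_prop_nseq (T : Type) (P : T -> Prop) k x : P x -> all_prop P (nseq k x).
Proof. by move=> Px; elim: k. Qed.

Lemma all_prop_mono (T : Type) (P Q : T -> Prop) s :
  (forall x, P x -> Q x) -> all_prop P s -> all_prop Q s.
Proof. by move=> PQ; elim: s => //= x s IH [/PQ Qx /IH]. Qed.

Lemma invertible_power (l : M) i b (r : M) k : inGL l -> inGL r ->
  all_prop (@invertible_letter D n) (power_hd l i b r k :: power_tl i b r k).
Proof.
move=> Gl Gr; have G1 := inGL1 D n; case: k => [|k] //=; split; first by [].
by apply/all_prop_cat; split=> //; apply: all_prop_nseq.
Qed.

Lemma reduced_power (l : M) i b (r : M) k :
  path_prop reduced (power_hd l i b r k) (power_tl i b r k).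
Proof.
case: k => [//|k]; rewrite /power_hd /power_tl; move: (1 : M) => r'.
elim: k l r' => [|k IH] l r' /=; first by split=> // _; case.
by split; [move=> _; case | exact: IH].
Qed.

(** Powers are spelled out as letters. The new junctions have coefficient 1 but join equal signs, so
    they are reduced; the head [a] moves to the other side as the constant [a']. *)
Lemma has_word_of_ggi (H : M -> Prop) (w : ggmonomial D n) :
  is_gen_monomial w -> satisfies_ggi H w -> has_word reduced H.
Proof.
case: w => a s [/= s0 [a' [aa' a'a]] sinv sjunc] sat.
pose b (e : nat * int * M) := if e.1.2 is Posz _ then true else false.
(* The absolute value of the exponent minus one, since [Negz m] is [-(m+1)]. *)
pose k (e : nat * int * M) := match e.1.2 with Posz m => m.-1 | Negz m => m end.
pose hd e := power_hd 1 e.1.1 (b e) e.2 (k e).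
pose tl e := power_tl e.1.1 (b e) e.2 (k e).
pose P (e : nat * int * M) := e.1.2 != 0 /\ inGL e.2.
pose J (e e' : nat * int * M) := e.1.1 = e'.1.1 -> b e <> b e' -> noncentral e.2.
have sP : all_prop P s.
  elim: s {s0 sjunc sat} sinv => [//|e s IH] sinv; split; first exact/sinv/mem_head.
  by apply: IH => e' e's; apply: sinv; rewrite in_cons e's orbT.
have sign e e' : P e -> P e' -> b e <> b e' -> e.1.2 * e'.1.2 < 0.
  rewrite /P /b; case: e e' => [[i [[|m]|m]] r] [[i' [[|m']|m']] r'] //= [// _ _] [// _ _] _.
case: s s0 sjunc sinv sat sP => [//|e s] _ sjunc sinv sat sP.
have sJ : path_prop J e s.
  elim: s e sjunc sP {sinv sat} => [//|e' s IH] e sjunc [Pe Ps]; split.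
    move=> ee' bb'; apply: noncentralP; first by case: Pe.
    by apply: (sjunc 0%N) => //; apply: sign => //; case: Ps.
  by apply: IH => // j js; apply: (sjunc j.+1).
exists (hd e), (tl e ++ expand hd tl s), a'; split.
- apply: (@all_prop_expand _ _ hd tl P _ (e :: s)) => // e' [_ Ge'].
  by have := invertible_power e'.1.1 (b e') (k e') (inGL1 D n) Ge'.
- apply: path_prop_expand sJ => [e'|e1 e2 J12]; first exact: reduced_power.
  have [l' ->] := last_power 1 e1.1.1 (b e1) e1.2 (k e1).
  by rewrite /hd /power_hd /reduced_junction /= mulr1.
move=> c ci Hc.
rewrite -[hd e :: _]/(expand hd tl (e :: s)).
rewrite (@weval_expand _ _ _ _ (fun e => gpow (c e.1.1) (ci e.1.1) e.1.2 * e.2)); last first.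
  apply: all_prop_mono sP => -[[i al] r] [/= al0 _].
  rewrite /hd /tl weval_power mul1r /b /k /=; move: al0; case: al => [[|m]|m] //=.
have := sat c ci Hc; rewrite /gm_eval [gm_head _]/= [gm_tail _]/=.
have -> : foldr (fun e z => gpow (c e.1.1) (ci e.1.1) e.1.2 * e.2 * z) 1 (e :: s)
   = eval_tail c ci (e :: s).
  by elim: (e :: s) => [//|[[i al] r] s' IH]; rewrite /= IH.
by move=> E; rewrite -[LHS]mul1r -a'a -mulrA E mulr1.
Qed.

(** Substitute [x_i^(N+1)] for [x_i]: the junctions created inside a power join letters of the same
    sign. *)
Lemma has_word_power (H K : M -> Prop) N : (forall x, K x -> H (x ^+ N.+1)) ->
  has_word reduced H -> has_word reduced K.
Proof.
move=> KH [e [w [d [winv wJ wd]]]].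
pose hd (e : lt) := power_hd (lco e) (lvar e) (lpos e) (rco e) N.
pose tl (e : lt) := power_tl (lvar e) (lpos e) (rco e) N.
exists (hd e), (tl e ++ expand hd tl w), d; split.
- apply: (@all_prop_expand _ _ hd tl _ _ (e :: w)) winv => e' [Gl Gr].
  exact: invertible_power.
- apply: path_prop_expand wJ => [e'|e1 e2 J12]; first exact: reduced_power.
  have [l' ->] := last_power (lco e1) (lvar e1) (lpos e1) (rco e1) N.
  move: J12; rewrite /hd /power_hd /reduced_junction /= => J12 v12 b12.
  exact: J12.
move=> c ci Kc; pose c' i := c i ^+ N.+1; pose ci' i := ci i ^+ N.+1.
rewrite -(wd c' ci') => [|i]; last first.
  have [Kci [cc cic]] := Kc i; split; first exact: KH.
  have comm : GRing.comm (c i) (ci i) by rewrite /GRing.comm cc.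
  by split; rewrite /c' /ci' -exprMn_comm ?cc ?cic ?expr1n //; exact: commr_sym.
rewrite -[hd e :: _]/(expand hd tl (e :: w)) (@weval_expand _ _ _ _ (leval c' ci')).
  by rewrite weval_foldr.
apply: all_prop_mono winv => e' _; rewrite /hd /tl weval_power /leval /c' /ci'.
by case: (lpos e').
Qed.

(** With [m] coset representatives, two of [x^0, ..., x^m] share a left coset, so [x^k] is in [H]
    for some [0 < k <= m]. Such a [k] divides [m!], which does not depend on [x]. *)
Lemma finite_index_power (H K : M -> Prop) : is_subgroup H -> is_subgroup K ->
  finite_index_in H K -> exists N, forall x, K x -> H (x ^+ N.+1).
Proof.
move=> [HGL H1 HM HV] [KGL K1 KM KV] [s Hs].
have HX x k : H x -> H (x ^+ k).
  by move=> Hx; elim: k => [|k IH]; rewrite ?expr0 // exprS; apply: HM.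
exists ((size s)`!.-1) => x Kx; rewrite prednK ?fact_gt0 //.
have KX k : K (x ^+ k).
  by elim: k => [|k IH]; rewrite ?expr0 // exprS; apply: KM.
have [k [k_gt0 ks Hk]] : exists k, [/\ (0 < k)%N, (k <= size s)%N & H (x ^+ k)].
  pose m := size s.
  have [f Hf] : exists f : nat -> nat, forall i, (i < m.+1)%N ->
      (f i < m)%N /\ exists h, H h /\ x ^+ i = nth 0 s (f i) * h.
    elim: m.+1 => [|j [f Hf]]; first by exists id.
    have [g gs [h [Hh xg]]] := Hs _ (KX j).
    exists (fun i => if i == j then index g s else f i) => i.
    rewrite ltnS leq_eqVlt; case: eqVneq => [-> _|_ /= /Hf //].
    by rewrite index_mem gs nth_index //; split=> //; exists h.
  (* Otherwise [f], whose values are below [m], would give an injective self-map of ['I_m.+1]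
     missing [ord_max]. *)
  have : exists i j, (i < j < m.+1)%N /\ f i = f j.
    apply: NNPP => noij.
    have ltfm (i : 'I_m.+1) : (f i < m.+1)%N by case: (Hf i (ltn_ord i)) => /ltnW.
    have inj : injective (fun i : 'I_m.+1 => inord (f i) : 'I_m.+1).
      move=> i j /(congr1 val) /=.
      rewrite !inordK ?ltfm // => fij; apply/val_inj/eqP; apply: contraT; rewrite neq_ltn => /orP[] lij;
        case: noij; [exists i, j | exists j, i]; by rewrite lij ltn_ord.
    have : ord_max \in codom (fun i : 'I_m.+1 => inord (f i) : 'I_m.+1).
      exact: injF_onto.
    case/codomP => i /(congr1 val) /=; rewrite inordK ?ltfm // => E.
    by have [] := Hf i (ltn_ord i); rewrite -E ltnn.
  case=> i [j [/andP[ij jm] fij]].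
  have [_ [h1 [Hh1 x1]]] := Hf i (ltn_trans ij jm).
  have [_ [h2 [Hh2 x2]]] := Hf j jm.
  exists (j - i)%N; split; first by rewrite subn_gt0.
    by rewrite leq_subLR (leq_trans _ (leq_addl _ _)).
  have [h1' [hh1 h1h]] := HGL _ Hh1; have [y [xy yx]] := KGL _ (KX i).
  suff -> : x ^+ (j - i) = h1' * h2 by apply: HM => //; apply: HV hh1 h1h.
  have xij : x ^+ i * x ^+ (j - i) = x ^+ j by rewrite -exprD subnKC // ltnW.
  rewrite -[LHS]mul1r -yx -mulrA xij x2 -fij.
  have -> : nth 0 s (f i) = x ^+ i * h1' by rewrite x1 -mulrA hh1 mulr1.
  by rewrite -!mulrA mulrA yx mul1r.
have /dvdnP[q ->] : (k %| (size s)`!)%N by rewrite dvdn_fact // k_gt0.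
by rewrite mulnC exprM; apply: HX.
Qed.

(* Substitute [x_i := (x_2i h x_2i^-1) (x_2i+1 h x_2i+1^-1)]. *)
Lemma has_word_normal (H K : M -> Prop) h : is_subgroup H -> is_subgroup K ->
  normal_in H K -> H h -> noncentral h ->
  has_word reduced H -> has_word strict K.
Proof.
move=> [HGL H1 HM HV] [KGL K1 KM KV] nHK Hh nch [e [w [d [winv wJ wd]]]].
have [h' [hh' h'h]] := HGL _ Hh.
have Gh := HGL _ Hh; have Gh' : inGL h' by exists h.
have G1 := inGL1 D n.
have nch' : noncentral h' by apply: noncentral_inverse nch.
(* The inverse of the substituted product has its two conjugates in reverse order, with [h'] in
   place of [h]. *)
pose v0 (e : lt) := if lpos e then (lvar e).*2 else (lvar e).*2.+1.
pose v1 (e : lt) := if lpos e then (lvar e).*2.+1 else (lvar e).*2.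
pose h0 (e : lt) := if lpos e then h else h'.
pose hd (e : lt) := Letter (lco e) (v0 e) true (h0 e).
pose tl (e : lt) := [:: Letter 1 (v0 e) false 1; Letter 1 (v1 e) true (h0 e);
                        Letter 1 (v1 e) false (rco e)].
have v01 (e' : lt) : v0 e' <> v1 e'.
  by rewrite /v0 /v1; case: (lpos e') => /(congr1 odd) /=; rewrite odd_double.
exists (hd e), (tl e ++ expand hd tl w), d; split.
- apply: (@all_prop_expand _ _ hd tl _ _ (e :: w)) winv => e' [Gl Gr].
  have Gh0 : inGL (h0 e') by rewrite /h0; case: (lpos e').
  by split; [split | do 3?split].
- apply: path_prop_expand wJ => [e'|e1 e2 J12].
    have nc0 : noncentral (h0 e') by rewrite /h0; case: (lpos e').
    do !split=> //; rewrite /strict_junction /= ?mulr1 // => /v01 //.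
  (* By parity, [v1 e1 = v0 e2] forces the same original variable with opposite signs, exactly the
     case in which a reduced junction has a noncentral coefficient. *)
  rewrite /strict_junction /= => v12; apply: J12; move: v12; rewrite /v0 /v1.
    by case: (lpos e1); case: (lpos e2) => /(congr1 half); rewrite /= ?uphalf_double ?doubleK.
  move=> + bb; rewrite bb; by case: (lpos e2) => /(congr1 odd); rewrite /= !odd_double.
move=> c ci Kc.
pose c' i := c i.*2 * h * ci i.*2 * (c i.*2.+1 * h * ci i.*2.+1).
pose ci' i := c i.*2.+1 * h' * ci i.*2.+1 * (c i.*2 * h' * ci i.*2).
rewrite -(wd c' ci') => [|i]; last first.
  have [K0 [cc0 cic0]] := Kc i.*2; have [K2 [cc1 cic1]] := Kc i.*2.+1.
  split; first by apply: HM; apply: nHK.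
  have conj x x' : inverses x x' -> inverses (x * h * x') (x * h' * x').
    move=> xx'; rewrite -[x * h' * x']mulrA; apply: inversesM; last by case: xx'.
    by apply: inversesM => //; split.
  by apply: inversesM; apply: conj.
rewrite -[hd e :: _]/(expand hd tl (e :: w)) (@weval_expand _ _ _ _ (leval c' ci')).
  by rewrite weval_foldr.
apply: all_prop_mono winv => e' _; rewrite /leval /c' /ci' /= /leval /= /v0 /v1 /h0.
by case: (lpos e'); rewrite !mulr1 ?mul1r !mulrA ?mul1r ?mulr1.
Qed.

Lemma has_word_reduced (H : M -> Prop) : has_word strict H -> has_word reduced H.
Proof.
move=> [e [w [d [winv wJ wd]]]]; exists e, w, d; split=> //.
by apply: path_prop_impl wJ => e1 e2 J12 v12 _; apply: J12.
Qed.

Lemma inGL_subgroup : is_subgroup (@inGL D n).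
Proof.
split=> //; [exact: inGL1 | by move=> A B; apply: inGLM |].
by move=> A B _ AB BA; exists A.
Qed.

Lemma inGL_normal : normal_in (@inGL D n) (@inGL D n).
Proof.
move=> x y h Gx xy yx Gh; have Gy : inGL y by exists x.
by do 2?apply: inGLM.
Qed.

(** The word climbs the chain from [G] to the full group; [h] lies in every term of the chain and so
    serves at each normal step. *)
Lemma has_word_GL (G : M -> Prop) h : is_subgroup G -> almost_subnormal G (@inGL D n) ->
  G h -> noncentral h -> has_word reduced G -> has_word strict (@inGL D n).
Proof.
move=> sG [r [chain [chain0 chainr chainG chainS]]] Gh nch wG.
have chainh j : (j <= r)%N -> chain (r - j)%N h /\ has_word reduced (chain (r - j)%N).
  elim: j => [|j IH] jr; first by rewrite subn0 chainr.
  have [ch wc] := IH (ltnW jr).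
  have lt : (r - j.+1 < r)%N by rewrite ltn_subrL (leq_trans _ jr).
  have [sub norm] := chainS _ lt.
  have E : ((r - j.+1).+1 = r - j)%N by rewrite subnSK.
  rewrite E in sub norm; split; first exact: sub.
  have sg1 := chainG _ (ltnW lt); have sg2 := chainG (r - j)%N (leq_subr _ _).
  case: norm => [nor|fin].
    exact/has_word_reduced/(has_word_normal sg2 sg1 nor ch nch wc).
  have [N HN] := finite_index_power sg2 sg1 fin.
  exact: has_word_power HN wc.
have [+ +] := chainh r (leqnn r); rewrite subnn chain0 => Gh' w.
(* One more normal step, from the full group to itself, makes all junctions strict. *)
exact: has_word_normal inGL_subgroup inGL_subgroup inGL_normal Gh' nch w.
Qed.

End Descent.

(** * Reduction to one variable *)

Section SingleVariable.
Variables (D : unitRingType) (n : nat).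
Local Notation M := 'M[D]_n.
Local Notation lt := (letter M).
Hypothesis infF : infinite_set (@ring_center D).

Lemma not_noncentral (a : M) : ~ noncentral a -> forall u, inGL u -> a * u = u * a.
Proof. by move=> nca u Gu; apply: NNPP => au; apply: nca; exists u. Qed.

Lemma commute_inverse (a a' u : M) : inverses a a' -> a * u = u * a -> a' * u = u * a'.
Proof.
move=> [aa' a'a] au; rewrite -[LHS]mulr1 -aa' !mulrA -(mulrA a' u) -au.
by rewrite mulrA a'a mul1r.
Qed.

(** An infinite family of units, pairwise distinct modulo the center: transvections for [n >= 2],
    the elements [1 + mu k] with [k] noncentral for [n = 1]. *)
Variables (g g' : D -> M) (s0 : seq D).
Hypothesis gK : forall mu, ring_center mu -> mu \notin s0 -> inverses (g mu) (g' mu).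
Hypothesis g_nc : forall mu nu, ring_center mu -> mu \notin s0 ->
  ring_center nu -> nu \notin s0 -> mu != nu -> noncentral (g' mu * g nu).

(* The [g mu] lie in distinct cosets of the center, so each [c] excludes at
   most one [mu]. *)
Lemma noncentral_translate (B : seq M) : (forall c, c \in B -> inGL c) ->
  exists x x', inverses x x' /\ forall c, c \in B -> noncentral (c * x).
Proof.
move=> GB; suff [s Hs] : exists s : seq D, forall mu, ring_center mu ->
    mu \notin s0 -> mu \notin s -> forall c, c \in B -> noncentral (c * g mu).
  have [mu [cmu]] := infF (s0 ++ s); rewrite mem_cat negb_or => /andP[mu0 mus].
  by exists (g mu), (g' mu); split; [exact: gK | exact: Hs].
elim: B GB => [|c B IH] GB; first by exists [::].
have [|s Hs] := IH; first by move=> b bB; apply: GB; rewrite in_cons bB orbT.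
have [[mu [cmu mu0 /not_noncentral cen]]|none] := classic (exists mu,
    [/\ ring_center mu, mu \notin s0 & ~ noncentral (c * g mu)]); last first.
  exists s => nu cnu nu0 nus b; rewrite in_cons => /predU1P[->|]; last exact: Hs.
  by apply: NNPP => nb; apply: none; exists nu.
exists (mu :: s) => nu cnu nu0; rewrite in_cons negb_or => /andP[numu nus] b.
rewrite in_cons => /predU1P[->|]; last exact: Hs.
apply: NNPP => /not_noncentral cen'.
have [|u Gu] := g_nc cmu mu0 cnu nu0; first by rewrite eq_sym.
have [c' cc'] := GB c (mem_head _ _).
have cmu' := commute_inverse (inversesM cc' (gK cmu mu0)) (cen u Gu).
have -> : g' mu * g nu = (g' mu * c') * (c * g nu).
  by rewrite mulrA -(mulrA (g' mu)) (proj2 cc') mulr1.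
by case; rewrite -mulrA cen' // !mulrA cmu' -!mulrA.
Qed.

(** Induction on [N]: the new member [x] makes all [h' k * a * x] noncentral. The pairs with [x'] on
    the left follow by inversion, which is why [A] is closed under inverses. *)
Lemma conjugating_family (A : seq M) N : (forall a, a \in A -> inGL a) ->
  (forall a, a \in A -> exists2 a', a' \in A & inverses a a') ->
  exists h h' : nat -> M, (forall k, inverses (h k) (h' k)) /\
    forall k l a, (k < N)%N -> (l < N)%N -> k != l -> a \in A ->
      noncentral (h' k * a * h l).
Proof.
move=> GA AV; elim: N => [|N [h [h' [hK hnc]]]].
  by exists (fun=> 1), (fun=> 1); split=> // _; split; rewrite mulr1.
have [|x [x' [xx' xnc]]] := @noncentral_translate [seq h' k * a | k <- iota 0 N, a <- A].
  move=> c /allpairsP[[k a] [/= _ aA ->]]; apply: inGLM; last exact: GA.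
  by have [_] := inverses_inGL (hK k).
exists (fun k => if k == N then x else h k), (fun k => if k == N then x' else h' k).
split=> [k|k l a]; first by case: eqP.
have lt_N j a' : (j < N)%N -> a' \in A -> noncentral (h' j * a' * x).
  move=> jN aA; apply: xnc; apply/allpairsP; exists (j, a').
  by rewrite mem_iota.
rewrite !ltnS [(k <= N)%N]leq_eqVlt [(l <= N)%N]leq_eqVlt.
case: (eqVneq k N) => [->|kN] /= Hk; case: (eqVneq l N) => [->|lN] /= Hl.
- by [].
- move=> _ aA; have [a' a'A aa'] := AV a aA.
  apply: noncentral_inverse (lt_N l a' Hl a'A).
  rewrite -[x' * a * _]mulrA; apply: inversesM xx'.
  by case: (hK l) => hh hh'; apply: inversesM; split=> //; case: aa'.
- by move=> _ aA; apply: lt_N.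
- by move=> kl aA; apply: hnc.
Qed.

(** Substitute [h_i x h_i^-1] for [x_i]. An inner coefficient [a] between variables [k] and [l]
    becomes [h_k^-1 a h_l]: noncentral by choice of the family if [k != l], and a conjugate of the
    noncentral [a] if [k = l]. *)
Lemma single_variable_word : has_word (@strict_junction D n) (@inGL D n) ->
  exists (e : lt) (w : seq lt) (d : M),
    [/\ all_prop (@invertible_letter D n) (e :: w),
        path_prop (fun e e' => noncentral (rco e * lco e')) e w
      & forall x x', inverses x x' -> weval (fun=> x) (fun=> x') (e :: w) = d].
Proof.
move=> [e [w [d [winv wJ wd]]]].
have [A [N [GA AV [eN wA]]]] : exists (A : seq M) N, [/\ forall a, a \in A -> inGL a,
    forall a, a \in A -> exists2 a', a' \in A & inverses a a' &
    (lvar e < N)%N /\ path_prop (fun e e' => [/\ (lvar e < N)%N, (lvar e' < N)%N &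
       rco e * lco e' \in A]) e w].
  elim: w e winv {wJ wd} => [|e' w IH] e /= [[_ Gre] winv].
    by exists [::], (lvar e).+1.
  have [A [N [GA AV [eN wA]]]] := IH e' winv.
  case: winv => [[Gle' _] _]; have [b ab] := inGLM Gre Gle'.
  exists (rco e * lco e' :: b :: A), (maxn N (lvar e).+1); split.
  - move=> a; rewrite !in_cons => /or3P[/eqP->|/eqP->|/GA //].
      by have [] := inverses_inGL ab.
    by have [] := inverses_inGL ab.
  - move=> a; rewrite !in_cons => /or3P[/eqP->|/eqP->|/AV[a' a'A aa']].
    + by exists b => //; rewrite !in_cons eqxx orbT.
    + by exists (rco e * lco e'); [rewrite mem_head | case: ab].
    + by exists a' => //; rewrite !in_cons a'A !orbT.
  - split; first by rewrite leq_max leqnn orbT.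
    split; first by rewrite !leq_max leqnn eN orbT mem_head.
    apply: path_prop_impl wA => e1 e2 [H1 H2 H3].
    by rewrite !leq_max H1 H2 !in_cons H3 !orbT.
have [h [h' [hK hnc]]] := conjugating_family N GA AV.
pose f (e : lt) := Letter (lco e * h (lvar e)) 0 (lpos e) (h' (lvar e) * rco e).
exists (f e), (map f w), d; split.
- rewrite -/(map f (e :: w)); elim: (e :: w) winv => [//|e' w' IH] /= [[Gl Gr] /IH ?].
  have [Gh Gh'] := inverses_inGL (hK (lvar e')).
  by split=> //; split; apply: inGLM.
- elim: w e wJ wA {winv wd eN} => [//|e' w IH] e /= [J wJ] [[eN e'N eA] wA].
  split; last exact: IH.
  rewrite -mulrA [rco e * _]mulrA mulrA.
  have [ee'|] := eqVneq (lvar e) (lvar e'); last by move=> ?; apply: hnc.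
  by rewrite ee'; apply: noncentral_conj => //; apply: J.
move=> x x' xx'.
rewrite -(wd (fun i => h i * x * h' i) (fun i => h i * x' * h' i)) => [|i].
  rewrite -[f e :: _]/(map f (e :: w)); elim: (e :: w) => [//|e' w' IH] /=.
  by rewrite IH /leval /=; case: (lpos e'); rewrite !mulrA.
have hxh : inverses (h i * x * h' i) (h i * x' * h' i).
  rewrite -[h i * x' * _]mulrA; apply: inversesM; last by case: (hK i).
  by apply: inversesM.
by split=> //; case: (inverses_inGL hxh).
Qed.

End SingleVariable.

(* [expansion w k] is the coefficient of [X^k] in the value at the vector [u] of
   the word [w], where [x = 1 + X y], [x^-1 = 1 - X y], i.e. as if [y^2 = 0]. *)
Section Expansion.
Variables (R : pzRingType) (V : zmodType) (op : R -> V -> V) (y : V -> V) (u : V).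
Hypothesis op0 : forall a, op a 0 = 0.
Hypothesis opM : forall a b v, op (a * b) v = op a (op b v).
Hypothesis y0 : y 0 = 0.

Definition expansion_step (b : bool) (f : nat -> V) (k : nat) : V :=
  f k + (if k is k'.+1 then (if b then y (f k') else - y (f k')) else 0).

Fixpoint expansion (w : seq (letter R)) : nat -> V :=
  if w is e :: w' then
    fun k => op (lco e) (expansion_step (lpos e) (fun j => op (rco e) (expansion w' j)) k)
  else fun k => if k is 0 then u else 0.

Lemma expansion_gt_size w k : (size w < k)%N -> expansion w k = 0.
Proof.
elim: w k => [|e w IH] [|k] //= lt_wk; rewrite /expansion_step.
rewrite (IH k) // (IH k.+1) ?op0 ?y0; last exact: ltnW.
by rewrite oppr0 if_same addr0 op0.
Qed.

Lemma expansion_top (K : V -> Prop) e w : (forall v, K v -> K (- v)) ->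
  path_prop (fun e e' => forall v, K v -> K (y (op (rco e * lco e') v))) e w ->
  K (y (op (rco (last e w)) u)) ->
  exists2 v, K v & expansion (e :: w) (size w).+1 = op (lco e) v.
Proof.
move=> KN; have Ksgn (b : bool) v : K v -> K (if b then v else - v).
  by case: b => // /KN.
elim: w e => [|e' w IH] e.
  move=> _ Ku; exists (if lpos e then y (op (rco e) u) else - y (op (rco e) u)).
    exact: Ksgn.
  by rewrite /= /expansion_step op0 add0r.
rewrite [path_prop _ _ _]/= [last _ _]/= => -[Jee' wJ] Kl; have [v Kv Ev] := IH e' wJ Kl.
exists (if lpos e then y (op (rco e * lco e') v) else - y (op (rco e * lco e') v)).
  exact/Ksgn/Jee'.
have -> : expansion [:: e, e' & w] (size w).+2 = op (lco e) (expansion_step (lpos e)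
    (fun j => op (rco e) (expansion (e' :: w) j)) (size w).+2) by [].
by rewrite /expansion_step expansion_gt_size //= op0 add0r opM -Ev.
Qed.

End Expansion.

(** * The case n >= 2 *)

Section CentralEvaluation.
Variables (D : unitRingType) (mu : D).
Hypothesis cmu : ring_center mu.

Lemma center_commr : commr_rmorph (@idfun D) mu.
Proof. by move=> x; rewrite /GRing.comm cmu. Qed.

(** Packaged as a ring morphism so that it can be applied to matrices and to polynomials over
    [{poly D}]. *)
Definition central_eval : {poly D} -> D := horner_morph center_commr.
HB.instance Definition _ := GRing.RMorphism.copy central_eval (horner_morph center_commr).

Lemma central_evalE p : central_eval p = p.[mu].
Proof. by rewrite /central_eval /horner_morph map_poly_id. Qed.

Lemma center_mx m n (A : 'M[D]_(m, n)) : A *m mu%:M = mu *: A.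
Proof.
apply/matrixP => i j; rewrite !mxE (bigD1 j) //= !mxE eqxx big1 ?addr0 //.
by move=> k /negbTE kj; rewrite !mxE kj mulr0.
Qed.

Lemma center_scalemxAr m n p (A : 'M[D]_(m, n)) (B : 'M[D]_(n, p)) :
  A *m (mu *: B) = mu *: (A *m B).
Proof. by rewrite -mul_scalar_mx mulmxA center_mx -scalemxAl. Qed.

End CentralEvaluation.

Lemma centerX (D : pzRingType) (mu : D) k : ring_center mu -> ring_center (mu ^+ k).
Proof. by move=> cmu y; apply/commr_sym/commrX => //; rewrite /GRing.comm cmu. Qed.

Lemma centerB (D : pzRingType) (mu nu : D) :
  ring_center mu -> ring_center nu -> ring_center (mu - nu).
Proof. by move=> cmu cnu y; rewrite mulrBl mulrBr cmu cnu. Qed.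

Lemma center0 (D : pzRingType) : ring_center (0 : D).
Proof. by move=> y; rewrite mul0r mulr0. Qed.

Lemma center1 (D : pzRingType) : ring_center (1 : D).
Proof. by move=> y; rewrite mul1r mulr1. Qed.

(** * Transvections and rank one maps of square zero *)

Section HigherRank.
Variables (D : unitRingType) (n' : nat).
Hypothesis divD : is_division_ring D.
Hypothesis infF : infinite_set (@ring_center D).
Local Notation n := n'.+2.
Local Notation M := 'M[D]_n.

Section Transvections.
Variables (i j : 'I_n).
Hypothesis ij : i != j.

Let E : M := delta_mx i j.

Lemma transvectionM (a b : D) : (1 + a *: E) * (1 + b *: E) = 1 + (a + b) *: E.
Proof.
have EE : (a *: E) * (b *: E) = 0.
  apply/matrixP => p q; rewrite !mxE big1 // => k _; rewrite !mxE.
  case: (eqVneq k j) => [->|_]; last by rewrite andbF mulr0 mul0r.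
  by rewrite [j == i]eq_sym (negbTE ij) /= !mulr0.
by rewrite mulrDl mul1r mulrDr mulr1 EE addr0 -addrA [b *: E + _]addrC -scalerDl.
Qed.

Lemma transvection_inverses (a : D) : inverses (1 + a *: E) (1 - a *: E).
Proof. by split; rewrite -scaleNr transvectionM ?subrr ?addNr scale0r addr0. Qed.

End Transvections.

Lemma transvection_noncentral (i j : 'I_n) (a : D) : i != j -> a != 0 ->
  noncentral (1 + a *: delta_mx i j : M).
Proof.
move=> ij a0; exists (1 + 1 *: delta_mx j i).
  by exists (1 - 1 *: delta_mx j i); apply: transvection_inverses; rewrite eq_sym.
rewrite !mulrDl !mulrDr !mul1r !mulr1 -!addrA => /addrI.
rewrite addrCA => /addrI /addrI; rewrite !scale1r.
move=> /matrixP /(_ i i); rewrite -!mulmxE -scalemxAl mul_delta_mx.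
rewrite !mxE eqxx mulr1 big1 => [/eqP|k _]; first by rewrite (negbTE a0).
by rewrite !mxE (negbTE ij) mul0r.
Qed.

(** This is [phi a v] for the row [phi = c - (c v) e_0], which kills [v] as soon as [v_0 = 1]. The
    ring [S] is arbitrary so that polynomial entries are allowed. *)
Definition pairing (S : pzRingType) (v : 'cV[S]_n) (c : 'rV[S]_n) (a : 'M[S]_n) : S :=
  ((c - (c *m v) *m delta_mx 0 0) *m a *m v) 0 0.

(** If all pairings vanish, [a] maps every [v] with [v_0 = 1] to a right multiple of itself. Testing
    [e_0] and [e_0 + e_j d] shows that [a] is a central scalar. *)
Lemma noncentral_pairing (a : M) : noncentral a ->
  exists2 vc : 'cV[D]_n * 'rV[D]_n, vc.1 0 0 = 1 & pairing vc.1 vc.2 a != 0.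
Proof.
move=> nca; apply: NNPP => none.
have key (v : 'cV[D]_n) k : v 0 0 = 1 -> (a *m v) k 0 = v k 0 * (a *m v) 0 0.
  move=> v1; apply/eqP; rewrite -subr_eq0; apply: contraPT none => nz.
  case; exists (v, delta_mx 0 k) => //=; apply: contra_neq nz.
  rewrite /pairing -mulmxA; move: (a *m v) => z <-.
  by rewrite mulmxBl -[_ *m delta_mx 0 0 *m _]mulmxA -!rowE !mxE big_ord1 !mxE.
have col0 k : k != 0 -> a k 0 = 0.
  move=> k0; have := key (delta_mx 0 0) k.
  by rewrite -colE !mxE eqxx (negbTE k0) mul0r => ->.
have colj j d k : j != 0 -> a k 0 + a k j * d =
   ((k == 0)%:R + d *+ (k == j)) * (a 0 0 + a 0 j * d).
  move=> j0; pose v : 'cV[D]_n := delta_mx 0 0 + \col_i (d *+ (i == j)).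
  have av l : (a *m v) l 0 = a l 0 + a l j * d.
    rewrite mulmxDr -colE !mxE (bigD1 j) //= !mxE eqxx big1 ?addr0 //.
    by move=> m /negbTE mj; rewrite !mxE mj mulr0.
  have := key v k; rewrite !av !mxE eqxx andbT => ->; first by rewrite andbT.
  by rewrite [0 == j]eq_sym (negbTE j0) addr0.
(* Comparing [d = 1] with a central [d = mu] other than 0 and 1 gives [a_0j (mu - 1) = 0]. *)
have row0 j : j != 0 -> a 0 j = 0.
  move=> j0; have [mu [cmu]] := infF [:: 0; 1].
  rewrite !inE negb_or => /andP[mu0 mu1].
  have E1 := colj j 1 j j0; have E2 := colj j mu j j0.
  rewrite (negbTE j0) eqxx col0 //= mulr0n !mulr1n !add0r !mulr1 mul1r in E1.
  rewrite (negbTE j0) eqxx col0 //= mulr0n mulr1n !add0r -cmu in E2.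
  have {}E2 := mulrI (divD mu0) E2.
  move/eqP: E2; rewrite E1 (inj_eq (addrI _)) => /eqP /(congr1 (fun z => z - a 0 j)).
  rewrite subrr -[X in _ * mu - X]mulr1 -mulrBr => /esym/eqP E2.
  apply/eqP/negPn/negP => aj; move: E2; apply/negP; apply: div_mulf_neq0 => //.
  by rewrite subr_eq0.
have diag j d : j != 0 -> a j j * d = d * a 0 0.
  move=> j0; have := colj j d j j0.
  by rewrite (negbTE j0) eqxx col0 //= mulr0n mulr1n !add0r (row0 j j0) mul0r addr0.
have aE : a = (a 0 0)%:M.
  apply/matrixP => k j; rewrite !mxE.
  have [->|j0] := eqVneq j 0; first by have [->|k0] := eqVneq k 0; rewrite /= ?mulr1n // (col0 k k0) mulr0n.
  case: (eqVneq k j) => [->|kj].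
    by have := diag j 1 j0; rewrite mulr1 mul1r => ->.
  have := colj j 1 k j0; rewrite (negbTE kj) (row0 j j0) mul0r addr0.
  have [->|k0] := eqVneq k 0; first by rewrite (row0 j j0) mulr0n.
  by rewrite (col0 k k0) !mulr0n !add0r mulr1 mul0r.
(* An index other than 0 exists because [n >= 2]; its diagonal entry equals [a_00], and [diag] makes
   it commute with every [d]. *)
have ca : ring_center (a 0 0).
  move=> d; have j0 : ord_max != 0 :> 'I_n by [].
  by have := diag _ d j0; have := diag _ 1 j0; rewrite mulr1 mul1r => ->.
by case: nca => u _; case; rewrite aE -!mulmxE center_mx // mul_scalar_mx.
Qed.

Lemma common_pairing (A : seq M) : (forall a, a \in A -> noncentral a) ->
  exists v : 'cV[D]_n, exists2 c : 'rV[D]_n, v 0 0 = 1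
    & forall a, a \in A -> pairing v c a != 0.
Proof.
move=> ncA.
pose comb (mu : D) (p q : 'cV[D]_n * 'rV[D]_n) :=
  ((1 - mu) *: p.1 + mu *: q.1, (1 - mu) *: p.2 + mu *: q.2).
have [||||[v c] /= v1 vcA] := @common_nonvanishing D divD infF _
    (fun p : 'cV[D]_n * 'rV[D]_n => p.1 0 0 = 1) comb M
    (fun a p => pairing p.1 p.2 a) A; last by exists v, c.
- by move=> mu p q _ /= p1 q1; rewrite !mxE p1 q1 !mulr1 subrK.
- move=> a p q.
  (* The line is drawn over [{poly D}] with ['X] for the parameter; its pairing is then the
     polynomial asked for, specialised at central [mu]. *)
  pose lin m k (x z : 'M[D]_(m, k)) : 'M[{poly D}]_(m, k) :=
    (1 - 'X) *: map_mx polyC x + 'X *: map_mx polyC z.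
  pose P := pairing (lin _ _ p.1 q.1) (lin _ _ p.2 q.2) (map_mx polyC a).
  have PE mu : ring_center mu -> P.[mu] = pairing (comb mu p q).1 (comb mu p q).2 a.
    move=> cmu; have ev := central_evalE cmu.
    have linE m k (x z : 'M[D]_(m, k)) : map_mx (central_eval cmu) (lin _ _ x z)
        = (1 - mu) *: x + mu *: z.
      by apply/matrixP => r s; rewrite !mxE ev !hornerE /= !(hornerM_comm, hornerE)
        /comm_poly ?hornerC ?cmu // !hornerE.
    have aE : map_mx (central_eval cmu) (map_mx polyC a) = a.
      by apply/matrixP => r s; rewrite !mxE ev hornerC.
    have dE : map_mx (central_eval cmu) (delta_mx 0 0) = delta_mx 0 0 :> 'rV_n.
      by rewrite map_delta_mx.
    rewrite -ev /P -[X in _ = pairing _ _ X]aE /comb -!linE /pairing -dE.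
    by rewrite -!map_mxM -map_mxB -!map_mxM [in RHS]mxE.
  exists P; split=> //.
    by rewrite PE ?/comb ?subr0 ?scale1r ?scale0r ?addr0 //; exact: center0.
  by rewrite PE ?/comb ?subrr ?scale1r ?scale0r ?add0r //; exact: center1.
- by exists (delta_mx 0 0, 0); rewrite /= mxE.
- by move=> a /ncA /noncentral_pairing.
Qed.

End HigherRank.

(** The additional [h] will act as the coefficient between the last letter and the vector to which
    the word is applied. *)
Lemma junction_list (R : pzRingType) (P : R -> Prop) (h : R) e w :
  P h -> path_prop (fun e e' : letter R => P (rco e * lco e')) e w ->
  exists A : seq R, [/\ forall a, a \in A -> P a, h \in A
    & path_prop (fun e e' : letter R => rco e * lco e' \in A) e w].
Proof.
move=> Ph; elim: w e => [|e' w IH] e /=.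
  by move=> _; exists [:: h]; split=> // [a|]; rewrite inE // => /eqP->.
case=> Pee' /IH[A [PA hA wA]]; exists (rco e * lco e' :: A); split.
- by move=> a; rewrite in_cons => /predU1P[->|/PA].
- by rewrite in_cons hA orbT.
split; first exact: mem_head.
by apply: path_prop_impl wA => e1 e2 H; rewrite in_cons H orbT.
Qed.

Lemma all_prop_last (T : Type) (P : T -> Prop) x s : all_prop P (x :: s) -> P (last x s).
Proof. by elim: s x => [|y s IH] x /= [Px] // /IH. Qed.

(** * Refutation of words for n >= 2 *)

Section HigherRankConclusion.
Variables (D : unitRingType) (n' : nat).
Hypothesis divD : is_division_ring D.
Hypothesis infF : infinite_set (@ring_center D).
Local Notation n := n'.+2.
Local Notation M := 'M[D]_n.

Lemma rank_ge2_no_word : has_word (@strict_junction D n) (@inGL D n) -> False.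
Proof.
pose i0 : 'I_n := 0; pose i1 : 'I_n := lift 0 0.
have i01 : i0 != i1 by [].
pose g (mu : D) : M := 1 + mu *: delta_mx i0 i1.
pose g' (mu : D) : M := 1 - mu *: delta_mx i0 i1.
have gK mu : inverses (g mu) (g' mu) by apply: transvection_inverses.
have gnc (mu nu : D) : mu != nu -> noncentral (g' mu * g nu).
  move=> munu; rewrite /g /g' -scaleNr transvectionM //.
  by apply: transvection_noncentral; rewrite // addrC subr_eq0 eq_sym.
move=> /(@single_variable_word D n infF g g' [::]) [].
- by move=> mu _ _; apply: gK.
- by move=> mu nu _ _ _ _; apply: gnc.
move=> e [w [d [winv wJ wd]]].
pose h : M := 1 + 1 *: delta_mx i0 i1.
have nch : noncentral h by apply: transvection_noncentral => //; exact: oner_neq0.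
have [A [ncA hA wA]] := junction_list nch wJ.
have [v [c v1 vcA]] := common_pairing divD infF ncA.
pose phi : 'rV[D]_n := c - (c *m v) *m delta_mx 0 0.
have phiv : phi *m v = 0.
  apply/matrixP => i j; rewrite !ord1 mulmxBl -[_ *m delta_mx 0 0 *m _]mulmxA -rowE.
  by rewrite !mxE big_ord1 !mxE v1 mulr1 subrr.
have phiA a : a \in A -> (phi *m a *m v) 0 0 != 0 by move=> /vcA.
have [[r' rr'] [l' l'l]] : inGL (rco (last e w)) /\ inGL (lco e).
  by have [_] := all_prop_last winv; case: winv => [[]].
pose y (z : 'cV[D]_n) := v *m phi *m z.
(* Chosen so that the last right coefficient sends [u] to [h v]. *)
pose u := r' *m (h *m v).
pose op (a : M) (z : 'cV[D]_n) := a *m z.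
have op0 a : op a 0 = 0 by apply: mulmx0.
have opM a b z : op (a * b) z = op a (op b z) by rewrite /op -mulmxA.
have y0 : y 0 = 0 by rewrite /y mulmx0.
(* For [a] in [A], [y a] sends [v k] to [v (phi a v) k], again a nonzero right multiple of [v]. *)
pose K (z : 'cV[D]_n) := exists2 k : 'M[D]_1, k 0 0 != 0 & z = v *m k.
have KN z : K z -> K (- z).
  by case=> k k0 ->; exists (- k); rewrite ?mulmxN // mxE oppr_eq0.
have KA a z : a \in A -> K z -> K (y (op a z)).
  move=> /phiA a0 [k k0 ->]; exists (phi *m a *m v *m k).
    by rewrite mxE big_ord1 div_mulf_neq0.
  by rewrite /y /op !mulmxA.
have Kv : K v.
  exists 1%:M; last by rewrite mulmx1.
  by rewrite mxE oner_neq0.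
have [||z0 [k k0 ->] Etop] := @expansion_top _ _ op y u op0 opM y0 K e w KN.
- by apply: path_prop_impl wA => e1 e2 eA z; apply: KA.
- have -> : op (rco (last e w)) u = op h v.
    by case: rr' => rr' _; rewrite /op /u mulmxA mulmxE rr' mul1mx.
  exact: KA.
pose X := expansion op y u.
have nil2 : (v *m phi) * (v *m phi) = 0.
  by rewrite -mulmxE mulmxA -(mulmxA v) phiv mulmx0 mul0mx.
(* Since [v phi] has square zero, [1 - mu v phi] is the exact inverse, and the value of the word on
   [u] is the polynomial in [mu] with coefficients [X s k]. *)
have eval mu : ring_center mu -> forall s : seq (letter M),
    weval (fun=> 1 + mu *: (v *m phi)) (fun=> 1 - mu *: (v *m phi)) s *m u
    = \sum_(k < (size s).+1) mu ^+ k *: X s k.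
  move=> cmu; elim=> [|e' s IH].
    by rewrite big_ord1 /= expr0 scale1r mul1mx.
  rewrite [weval _ _ _]/= -mulmxE -mulmxA IH /leval -!mulmxE -!mulmxA.
  pose Z k := op (rco e') (X s k).
  have -> : rco e' *m (\sum_(k < (size s).+1) mu ^+ k *: X s k)
      = \sum_(k < (size s).+1) mu ^+ k *: Z k.
    by rewrite mulmx_sumr; apply: eq_bigr => k1 _; rewrite center_scalemxAr //; apply: centerX.
  have -> : \sum_(k < (size (e' :: s)).+1) mu ^+ k *: X (e' :: s) k
      = lco e' *m \sum_(k < (size s).+2) mu ^+ k *: expansion_step y (lpos e') Z k.
    rewrite mulmx_sumr; apply: eq_bigr => k1 _.
    by rewrite center_scalemxAr //; apply: centerX.
  congr (_ *m _); rewrite /expansion_step.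
  under [RHS]eq_bigr => k1 _ do rewrite scalerDr.
  have ZN : Z (size s).+1 = 0 by rewrite /Z /X expansion_gt_size // op0.
  rewrite big_split [X in _ = _ X _]big_ord_recr [X in _ = _ _ X]big_ord_recl /=.
  rewrite ZN !scaler0 addr0 add0r.
  have yT : v *m phi *m (\sum_(k < (size s).+1) mu ^+ k *: Z k)
      = \sum_(k < (size s).+1) mu ^+ k *: y (Z k).
    rewrite mulmx_sumr; apply: eq_bigr => k1 _.
    by rewrite center_scalemxAr //; apply: centerX.
  case: (lpos e').
    rewrite mulmxDl mul1mx -scalemxAl yT scaler_sumr; congr (_ + _).
    by apply: eq_bigr => k1 _; rewrite scalerA -exprS.
  rewrite mulmxBl mul1mx -scalemxAl yT scaler_sumr -sumrN; congr (_ + _).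
  by apply: eq_bigr => k1 _; rewrite scalerA -exprS scalerN.
(* Each entry of this polynomial is constant at all central [mu], so its coefficients of positive
   degree vanish. *)
have Xtop : X (e :: w) (size w).+1 = 0.
  apply/matrixP => i j; rewrite ord1 [RHS]mxE.
  pose P := \poly_(k < (size w).+2) (X (e :: w) k i 0) - ((d *m u) i 0)%:P.
  have P0 : P = 0.
    apply: (poly_eq0_of_central_values divD infF (s := [::])) => mu cmu _.
    have inv : inverses (1 + mu *: (v *m phi)) (1 - mu *: (v *m phi)).
      have sq : (mu *: (v *m phi)) * (mu *: (v *m phi)) = 0.
        by rewrite -mulmxE center_scalemxAr // -scalemxAl mulmxE nil2 !scaler0.
      split; first by rewrite mulrDl mul1r mulrBr mulr1 sq subr0 addrNK.
      by rewrite mulrBl mul1r mulrDr mulr1 sq addr0 addrK.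
    rewrite /P hornerD hornerN hornerC -(wd _ _ inv) (eval _ cmu) summxE horner_poly.
    apply/eqP; rewrite subr_eq0; apply/eqP; apply: eq_bigr => k1 _.
    by rewrite [in RHS]mxE (centerX _ cmu).
  have := congr1 (fun p : {poly D} => p`_(size w).+1) P0.
  by rewrite /P coefB coef_poly ltnSn coefC subr0 coef0.
move: Etop; rewrite -/X Xtop /op => /(congr1 (mulmx l')).
rewrite mulmx0 mulmxA [l' *m lco e](proj2 l'l) mul1mx => /matrixP /(_ 0 0).
by rewrite !mxE big_ord1 v1 mul1r => /esym/eqP; rewrite (negbTE k0).
Qed.

End HigherRankConclusion.

(** * The case n = 1 *)

Section FormalWords.
Variable A : nzRingType.

(** The inverse of [1 + y X] modulo [X^m]. *)
Definition geometric (m : nat) (y : A) : {poly A} := \sum_(k < m) (- (y%:P * 'X)) ^+ k.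

(* The value modulo [X^m] of a word at [x = 1 + y X]. *)
Fixpoint formal_word (m : nat) (y : A) (s : seq (letter A)) : {poly A} :=
  if s is e :: s' then
    (lco e)%:P * ((if lpos e then 1 + y%:P * 'X else geometric m y)
      * ((rco e)%:P * formal_word m y s'))
  else 1.

Lemma geometricE m (y : A) :
  (1 + y%:P * 'X) * geometric m y = 1 - (- y) ^+ m *: 'X^m /\
  geometric m y * (1 + y%:P * 'X) = 1 - (- y) ^+ m *: 'X^m.
Proof.
set z := - (y%:P * 'X); have -> : 1 + y%:P * 'X = - (z - 1) by rewrite opprB opprK.
have zm : z ^+ m = (- y) ^+ m *: 'X^m.
  rewrite /z -mulNr -polyCN exprMn_comm -?polyC_exp ?mul_polyC //.
  exact: commr_polyX.
have comm : (z - 1) * geometric m y = geometric m y * (z - 1).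
  apply: commr_sum => k _; apply: commrX; apply: commr_sym.
  by apply: commrB => //; exact: commr1.
by rewrite mulNr mulrN -comm -subrX1 zm opprB.
Qed.

End FormalWords.

Definition letter_map (A B : Type) (f : A -> B) (e : letter A) :=
  Letter (f (lco e)) (lvar e) (lpos e) (f (rco e)).

Lemma map_formal_word (A B : nzRingType) (f : {rmorphism A -> B}) m y s :
  map_poly f (formal_word m y s) = formal_word m (f y) (map (letter_map f) s).
Proof.
elim: s => [|e s IH] /=; first by rewrite rmorph1.
rewrite !rmorphM /= !map_polyC /= IH; congr (_ * (_ * _)).
case: (lpos e); first by rewrite rmorphD rmorph1 rmorphM /= map_polyC map_polyX.
rewrite /geometric rmorph_sum; apply: eq_bigr => k _.
by rewrite rmorphXn rmorphN rmorphM /= map_polyC map_polyX.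
Qed.

(** * From values at central points to formal coefficients *)

Section Formal.
Variable D : unitRingType.
Hypothesis divD : is_division_ring D.
Hypothesis infF : infinite_set (@ring_center D).
Implicit Types (y : D) (s : seq (letter D)).

Lemma polyX_factor (p : {poly D}) : p`_0 = 0 -> exists q, p = q * 'X.
Proof.
move=> p0; have /factor_theorem[q] : root p 0 by rewrite /root horner_coef0 p0.
by rewrite subr0; exists q.
Qed.

(** If [R] has zero constant term then so has [S], because [q] has constant term 1; a factor [X] is
    cancelled from both until the constant term of [R] is nonzero. *)
Lemma right_ore_unitary (p q : {poly D}) : q`_0 = 1 ->
  exists R S : {poly D}, R`_0 != 0 /\ p * R = q * S.
Proof.
move=> q0; have [|R [S [R0 pR]]] := right_ore divD p (q := q).
  by apply: contra_eq_neq q0 => ->; rewrite coef0 eq_sym oner_neq0.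
move: {2}(size R) (leqnn (size R)) => m; elim: m R S R0 pR => [|m IH] R S R0 pR.
  by rewrite size_poly_leq0 (negbTE R0).
have [R00|] := eqVneq R`_0 0; last by exists R, S.
have S00 : S`_0 = 0.
  have := congr1 (fun p : {poly D} => p`_0) pR.
  by rewrite !coef0M R00 q0 mulr0 mul1r.
have [R1 RE] := polyX_factor R00; have [S1 SE] := polyX_factor S00.
have R10 : R1 != 0 by apply: contraNneq R0 => R10; rewrite RE R10 mul0r.
rewrite RE size_mulX // ltnS; move=> sR; apply: (IH R1 S1 R10 _ sR).
apply/polyP => i; have := congr1 (fun p : {poly D} => p`_i.+1) pR.
by rewrite RE SE !mulrA !coefMX /=.
Qed.

(* Common denominators: the word times [Q] is the polynomial [N], both as a
   formal power series and after specialising [X] to a central value. *)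
Lemma word_denominator y s : exists Q N : {poly D}, [/\ Q`_0 != 0,
  (forall mu, ring_center mu -> 1 + mu * y != 0 ->
    weval (fun=> 1 + mu * y) (fun=> (1 + mu * y)^-1) s * Q.[mu] = N.[mu])
  & forall m, exists E, formal_word m y s * Q = N + E * 'X^m].
Proof.
pose q : {poly D} := 1 + y%:P * 'X.
have q0 : q`_0 = 1 by rewrite coefD coef1 coefMX addr0.
have qE mu : ring_center mu -> q.[mu] = 1 + mu * y.
  by move=> cmu; rewrite hornerD hornerC hornerMX hornerC cmu.
elim: s => [|e s [Q [N [Q0 Nval Nform]]]].
  exists 1, 1; split; first by rewrite coef1 oner_neq0.
    by move=> mu _ _ /=; rewrite mul1r.
  by move=> m; exists 0; rewrite mul0r addr0 mulr1.
case: e => l i [] r.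
  exists Q, (l%:P * (q * (r%:P * N))); split=> // [mu cmu mu0|m].
    have ev := central_evalE cmu.
    rewrite -[RHS]ev !rmorphM /= !ev !hornerC qE // -Nval //.
    by rewrite /leval /= !mulrA.
  have [E EQ] := Nform m; exists (l%:P * (q * (r%:P * E))).
  by rewrite /= -!mulrA EQ !mulrDr !mulrA.
(* For an inverse letter the Ore relation [r N R = q S] gives [q^-1 r N R = S], so [R] extends the
   denominator. *)
have [R [S [R0 RS]]] := right_ore_unitary (r%:P * N) q0.
exists (Q * R), (l%:P * S); split.
- by rewrite coef0M div_mulf_neq0.
- move=> mu cmu mu0; have := Nval mu cmu mu0; have ev := central_evalE cmu.
  have := congr1 (central_eval cmu) RS; rewrite !rmorphM /= !ev hornerC qE // => RS'.
  move=> NE; rewrite -[(Q * R).[mu]]ev -[RHS]ev !rmorphM /= !ev hornerC.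
  rewrite /leval /= -!mulrA [weval _ _ _ * _]mulrA NE.
  by rewrite (mulrA r) RS' mulKr // divD.
move=> m; have [E EQ] := Nform m; have [_] := geometricE m y; rewrite -/q => geo.
exists (l%:P * (geometric m y * (r%:P * E) * R - (- y) ^+ m *: S)).
have cX (p : {poly D}) : 'X^m * p = p * 'X^m by rewrite commr_polyXn.
have -> : formal_word m y (Letter l i false r :: s) * (Q * R)
    = l%:P * (geometric m y * (r%:P * (formal_word m y s * Q) * R)).
  by rewrite /= !mulrA.
have -> : r%:P * (formal_word m y s * Q) * R = q * S + r%:P * E * R * 'X^m.
  by rewrite EQ mulrDr mulrDl RS -!mulrA cX.
rewrite mulrDr [geometric m y * (q * S)]mulrA geo mulrBl mul1r -scalerAl cX.
by rewrite -(mulrA l%:P (_ - _)) -mulrDr mulrBl -scalerAl !mulrA addrAC addrA.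
Qed.

(** Agreement at almost all central values gives [N = d Q]. Then [(f - d) Q], with [f] the formal
    word, vanishes modulo [X^m], and [Q] can be cancelled since its constant term is nonzero. *)
Lemma formal_word_coef y s d k m :
  (forall x, x != 0 -> weval (fun=> x) (fun=> x^-1) s = d) ->
  (0 < k < m)%N -> (formal_word m y s)`_k = 0.
Proof.
move=> sd /andP[k_gt0 km]; have [Q [N [Q0 Nval Nform]]] := word_denominator y s.
have NE : N = d%:P * Q.
  have [|t Ht] := @central_roots_finite D divD (1 + y%:P * 'X).
    apply/eqP => /(congr1 (fun p : {poly D} => p`_0))/eqP.
    by rewrite coefD coef1 coefMX addr0 coef0 oner_eq0.
  apply/eqP; rewrite -subr_eq0; apply/eqP.
  apply: (poly_eq0_of_central_values divD infF (s := t)) => mu cmu mut.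
  have mu0 : 1 + mu * y != 0.
    apply: contra mut => /eqP mu0; apply: Ht => //.
    by rewrite hornerD hornerC hornerMX hornerC -cmu.
  have ev := central_evalE cmu.
  rewrite hornerD hornerN -Nval // sd // -[X in _ - X]ev rmorphM /= !ev hornerC.
  by rewrite subrr.
have [E EQ] := Nform m; pose f := formal_word m y s - d%:P.
have fQ : f * Q = E * 'X^m by rewrite mulrBl EQ NE addrC addKr.
suff f0 : forall j, (j < m)%N -> f`_j = 0.
  by move: (f0 k km); rewrite coefB coefC eqn0Ngt k_gt0 subr0.
elim/ltn_ind => j IH jm.
have := congr1 (fun p : {poly D} => p`_j) fQ.
rewrite coefMXn jm coefM big_ord_recr /= subnn big1 ?add0r.
  move/eqP; apply: contraTeq => fj; exact: div_mulf_neq0.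
by move=> i _; rewrite IH ?mul0r // (ltn_trans _ jm).
Qed.

(** Specialising the parameter [p] at a central [mu] reduces to a parameter in [D]; the coefficient
    is a polynomial vanishing at every central [mu]. *)
Lemma formal_word_coef_poly (p : {poly D}) s d k m :
  (forall x, x != 0 -> weval (fun=> x) (fun=> x^-1) s = d) ->
  (0 < k < m)%N ->
  (formal_word m p (map (letter_map polyC) s))`_k = 0.
Proof.
move=> sd km; apply: (poly_eq0_of_central_values divD infF (s := [::])) => mu cmu _.
rewrite -(central_evalE cmu) -coef_map map_formal_word -map_comp.
rewrite -[RHS](@formal_word_coef (central_eval cmu p) s d k m) //.
congr (formal_word _ _ _)`_k; rewrite -[RHS]map_id; apply: eq_map => -[l i b r].
by rewrite /letter_map /= !central_evalE !hornerC.
Qed.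

End Formal.

(** * Density and conclusion *)

Section Density.
Variable D : unitRingType.
Hypothesis divD : is_division_ring D.
Variable b : D.

(* [D] is a module over [{poly D}], with constants acting by left multiplication
   and ['X] by right multiplication by [b]; its endomorphisms are the right
   multiplications by [C]. *)
Definition act (p : {poly D}) (v : D) : D := (p * v%:P).[b].

Local Notation C := (fun c : D => c * b = b * c).

Lemma act_add p q v : act (p + q) v = act p v + act q v.
Proof. by rewrite /act mulrDl hornerD. Qed.

Lemma act_sub p q v : act (p - q) v = act p v - act q v.
Proof. by rewrite /act mulrBl hornerD hornerN. Qed.

Lemma act_vadd p v w : act p (v + w) = act p v + act p w.
Proof. by rewrite /act polyCD mulrDr hornerD. Qed.

Lemma act_vopp p v : act p (- v) = - act p v.
Proof. by rewrite /act polyCN mulrN hornerN. Qed.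

Lemma act_vsub p v w : act p (v - w) = act p v - act p w.
Proof. by rewrite act_vadd act_vopp. Qed.

Lemma act_v0 p : act p 0 = 0.
Proof. by rewrite /act mulr0 horner0. Qed.

Lemma act0 v : act 0 v = 0.
Proof. by rewrite /act mul0r horner0. Qed.

Lemma actC a v : act a%:P v = a * v.
Proof. by rewrite /act -polyCM hornerC. Qed.

Lemma actX v : act 'X v = v * b.
Proof. by rewrite /act -commr_polyX hornerMX hornerC. Qed.

(** Modulo the left ideal of [X - b] a polynomial is congruent to its value at [b], and left
    multiplication preserves that ideal. *)
Lemma actM p q v : act (p * q) v = act p (act q v).
Proof.
rewrite /act -mulrA; set h := q * v%:P; apply/eqP; rewrite -subr_eq0 -hornerN -hornerD.
rewrite -mulrBr; have /factor_theorem[k ->] : root (h - (h.[b])%:P) b.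
  by rewrite /root hornerD hornerN hornerC subrr.
by rewrite mulrA; apply/factor_theorem; exists (p * k).
Qed.

Lemma act_vmul p v c : C c -> act p (v * c) = act p v * c.
Proof.
move=> cb; rewrite /act polyCM mulrA hornerM_comm ?hornerC //.
by rewrite /comm_poly hornerC cb.
Qed.

Lemma centralizer_inv c : c != 0 -> C c -> C c^-1.
Proof.
move=> /divD uc cb; apply: (mulrI uc).
by rewrite mulrA divrr // mul1r mulrA cb -mulrA divrr // mulr1.
Qed.

Fixpoint right_span (s : seq D) (v : D) : Prop :=
  if s is x :: s' then exists2 c, C c & right_span s' (v - x * c) else v = 0.

Lemma right_spanM s v c : C c -> right_span s v -> right_span s (v * c).
Proof.
move=> cb; elim: s v => [|x s IH] v /=; first by move=> ->; rewrite mul0r.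
case=> a ab /IH Hs; exists (a * c); last by rewrite mulrA -mulrBl.
by rewrite -mulrA cb mulrA ab mulrA.
Qed.

Lemma right_spanN s v : right_span s v -> right_span s (- v).
Proof.
rewrite -[- v]mulr1 mulNr -mulrN; apply: right_spanM.
by rewrite mulNr mulrN mul1r mulr1.
Qed.

Lemma act_right_span p s v : (forall x, x \in s -> act p x = 0) ->
  right_span s v -> act p v = 0.
Proof.
elim: s v => [|x s IH] v ps /=; first by move=> ->; rewrite act_v0.
case=> c cb /IH; rewrite act_vsub act_vmul // (ps x (mem_head _ _)) mul0r subr0; apply.
by move=> z zs; apply: ps; rewrite in_cons zs orbT.
Qed.

(** Jacobson's argument by induction on [s]. Take [p0] killing [s] with [p0 x = 1]; if everything
    killing [s] and [x] also killed [v], then [v - x c] with [c = p0 v] would contradict the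
    induction hypothesis. *)
Lemma density s v : ~ right_span s v ->
  exists2 p, forall x, x \in s -> act p x = 0 & act p v = 1.
Proof.
elim: s v => [|x s IH] v /= nspan.
  have /divD uv : v != 0 by apply/eqP.
  by exists (v^-1)%:P => //; rewrite actC mulVr.
have C0 : C 0 by rewrite mul0r mulr0.
have [xs|/IH[p0 p0s p0x]] := classic (right_span s x).
  have [|p ps pv] := IH v.
    by move=> vs; apply: nspan; exists 0 => //; rewrite mulr0 subr0.
  exists p => // z; rewrite in_cons => /predU1P[->|/ps //].
  exact: act_right_span xs.
apply: NNPP => none.
have kill p : (forall z, z \in s -> act p z = 0) -> act p x = 0 -> act p v = 0.
  move=> ps px; apply: NNPP => /eqP pv; apply: none.
  exists (((act p v)^-1)%:P * p); last by rewrite actM actC mulVr // divD.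
  by move=> z; rewrite in_cons actM actC => /predU1P[->|/ps ->]; rewrite ?px mulr0.
pose c := act p0 v.
(* [X p0 - b p0] kills [s] and [x], hence [v], which says [c b = b c]. *)
have cb : C c.
  have := kill ('X * p0 - b%:P * p0).
  rewrite !act_sub !actM actX actC actX actC p0x mul1r mulr1 subrr => H.
  apply/eqP; rewrite -subr_eq0; apply/eqP; apply: H => // z zs.
  by rewrite act_sub !actM actX actC p0s // mul0r mulr0 subr0.
have [|p ps pv] := IH (v - x * c); first by move=> H; apply: nspan; exists c.
(* This polynomial kills [s] and [x], hence [v]; so [p] kills [v - x c], which it was chosen to send
   to 1. *)
have := kill (p - (act p x)%:P * p0).
rewrite !act_sub !actM !actC p0x mulr1 subrr => H.
have {}H : act p v - act p x * c = 0.
  by apply: H => // z zs; rewrite act_sub actM actC ps // p0s // mulr0 subr0.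
by move: pv; rewrite act_vsub act_vmul // H => /eqP; rewrite eq_sym oner_eq0.
Qed.

(** An [x] in the span of [v] and [s] goes to its [v]-coordinate, already in [C]. Any other [x] is
    added to [s] and killed; exchange keeps [v] outside the larger span. *)
Lemma density_centralizer (t s : seq D) (v : D) : ~ right_span s v ->
  exists p, [/\ forall x, x \in s -> act p x = 0, act p v = 1
    & forall x, x \in t -> C (act p x)].
Proof.
elim: t s v => [|x t IH] s v nspan.
  by have [p ps pv] := density nspan; exists p; split.
have [[c cb xspan]|nx] := classic (right_span (v :: s) x).
  have [p [ps pv pt]] := IH s v nspan; exists p; split=> // z.
  rewrite in_cons => /predU1P[->|/pt //].
  have := act_right_span ps xspan; rewrite act_vsub act_vmul // pv mul1r.
  by move/eqP; rewrite subr_eq0 => /eqP ->.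
have [|p [ps pv pt]] := IH (x :: s) v; last first.
  exists p; split=> // [z zs|z]; first by apply: ps; rewrite in_cons zs orbT.
  rewrite in_cons => /predU1P[->|/pt //]; rewrite ps ?mem_head //.
  by rewrite mul0r mulr0.
case=> c cb vspan; apply: nx.
have [c0|c0] := eqVneq c 0.
  by case: nspan; move: vspan; rewrite c0 mulr0 subr0.
exists c^-1; first exact: centralizer_inv.
have := right_spanN (right_spanM (centralizer_inv c0 cb) vspan).
by rewrite mulrBl mulrK ?divD // opprB.
Qed.

Hypothesis infF : infinite_set (@ring_center D).

(** The span of 1 is [C], which contains no [a] of [A]. Density thus treats each [a] separately, and
    central lines combine the solutions. *)
Lemma act_generic (t A : seq D) : (forall a, a \in A -> a * b <> b * a) ->
  exists p, [/\ act p 1 = 0, forall x, x \in t -> C (act p x)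
    & forall a, a \in A -> act p a != 0].
Proof.
move=> nA.
pose Phi p := act p 1 = 0 /\ forall x, x \in t -> C (act p x).
pose comb (mu : D) (p q : {poly D}) := (1 - mu)%:P * p + mu%:P * q.
have combE mu p q v : act (comb mu p q) v = (1 - mu) * act p v + mu * act q v.
  by rewrite act_add !actM !actC.
have [||||p [p1 pt] pA] := @common_nonvanishing D divD infF _ Phi comb D
    (fun a p => act p a) A; last by exists p.
- move=> mu p q cmu [p1 pt] [q1 qt]; split=> [|x xt].
    by rewrite combE p1 q1 !mulr0 addr0.
  have c1 := centerB (@center1 D) cmu.
  by rewrite combE mulrDl mulrDr -!mulrA pt // qt // !mulrA c1 cmu.
- move=> a p q; pose P := (1 - 'X) * (act p a)%:P + 'X * (act q a)%:P.
  have PE mu : ring_center mu -> P.[mu] = act (comb mu p q) a.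
    move=> cmu; rewrite combE -(central_evalE cmu) rmorphD !rmorphM rmorphB rmorph1 /=.
    by rewrite !central_evalE hornerX !hornerC.
  exists P; split=> //.
    by rewrite PE ?combE ?subr0 ?mul1r ?mul0r ?addr0 //; exact: center0.
  by rewrite PE ?combE ?subrr ?mul1r ?mul0r ?add0r //; exact: center1.
- by exists 0; split=> [|x _]; rewrite act0 // mul0r mulr0.
move=> a aA; have [|p [p1 pa pt]] := @density_centralizer t [:: 1] a.
  case=> c cb /= /eqP; rewrite mul1r subr_eq0 => /eqP ac.
  by apply: nA aA _; rewrite ac.
exists p; last by rewrite pa oner_neq0.
by split=> //; apply: p1; rewrite mem_head.
Qed.

End Density.

(** * Refutation of words for n = 1 *)

Section RankOne.
Variable D : unitRingType.
Hypothesis divD : is_division_ring D.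
Hypothesis infF : infinite_set (@ring_center D).
Implicit Types (e : letter D) (w s : seq (letter D)).

Lemma common_noncommuting (A : seq D) : (forall a, a \in A -> ~ ring_center a) ->
  exists b, forall a, a \in A -> a * b <> b * a.
Proof.
move=> ncA.
pose comb (mu p q : D) := (1 - mu) * p + mu * q.
have [||||b _ bA] := @common_nonvanishing D divD infF _ (fun=> True) comb D
    (fun a p => a * p - p * a) A; last first.
- by exists b => a /bA; rewrite subr_eq0 => /eqP.
- move=> a /ncA nca; apply: NNPP => none; apply: nca => x.
  by apply: NNPP => ax; apply: none; exists x => //; rewrite subr_eq0; apply/eqP.
- by exists 0.
- move=> a p q; pose P := (1 - 'X) * (a * p - p * a)%:P + 'X * (a * q - q * a)%:P.
  have PE mu : ring_center mu -> P.[mu] = a * comb mu p q - comb mu p q * a.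
    move=> cmu; rewrite -(central_evalE cmu) rmorphD !rmorphM rmorphB rmorph1 /=.
    rewrite !central_evalE hornerX !hornerC /comb.
    have c1 := centerB (@center1 D) cmu.
    by rewrite (mulrDr a) (mulrDl _ _ a) 2!(mulrA a) -(c1 a) -(cmu a) !mulrBr !mulrA opprD addrACA.
  exists P; split=> //.
    by rewrite PE /comb ?subr0 ?mul1r ?mul0r ?addr0 //; exact: center0.
  by rewrite PE /comb ?subrr ?mul1r ?mul0r ?add0r //; exact: center1.
- by [].
Qed.

(* Vectors, independent of [y], whose combinations contain the [expansion] of
   [s] ([suffix_products]) and the vectors to which [y] is applied in it
   ([y_arguments]). *)
Fixpoint suffix_products (u : D) s : seq D :=
  if s is e :: s' then lco e :: [seq lco e * rco e * x | x <- suffix_products u s']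
  else [:: u].

Fixpoint y_arguments (u : D) s : seq D :=
  if s is e :: s' then [seq rco e * x | x <- suffix_products u s'] ++ y_arguments u s'
  else [::].

Section Action.
Variables (b u : D) (p : {poly D}).
Local Notation C := (fun c : D => c * b = b * c).
Local Notation y := (act b p).
Local Notation X := (expansion (fun a v : D => a * v) y u).
Hypothesis p1 : y 1 = 0.

Lemma centralizer_sgn (c : bool) v : C v -> C (if c then v else - v).
Proof. by case: c => // vb; rewrite mulNr mulrN vb. Qed.

Lemma act_expansion_centralizes s a k :
  (forall x, x \in y_arguments u s -> C (y x)) ->
  (forall x, x \in suffix_products u s -> C (y (a * x))) -> C (y (a * X s k)).
Proof.
have C0 : C 0 by rewrite mul0r mulr0.
elim: s a k => [|e s IH] a k ys ya.
  case: k => [|k] /=; first by apply: ya; rewrite mem_head.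
  by rewrite mulr0 act_v0.
have ys' x : x \in y_arguments u s -> C (y x).
  by move=> xs; apply: ys; rewrite mem_cat xs orbT.
pose c := if k is k'.+1 then
  (if lpos e then y (rco e * X s k') else - y (rco e * X s k')) else 0.
have -> : a * X (e :: s) k = a * (lco e * rco e) * X s k + a * lco e * c.
  by rewrite /= /expansion_step -/c !mulrDr !mulrA.
have H1 : C (y (a * (lco e * rco e) * X s k)).
  apply: IH => // x xs; rewrite -mulrA; apply: ya.
  by rewrite in_cons (map_f (fun x => lco e * rco e * x)) ?orbT.
have Cc : C c.
  rewrite /c; case: k {c H1} => [//|k]; apply: centralizer_sgn.
  by apply: IH => // x xs; apply: ys; rewrite mem_cat map_f.
have Cl : C (y (a * lco e)) by apply: ya; rewrite mem_head.
by rewrite act_vadd (act_vmul _ _ Cc) mulrDl mulrDr H1 -(mulrA (y _)) Cc (mulrA (y _)) Cl -(mulrA b).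
Qed.

(** For [z] with [y z] in [C], [y (y z) = y 1 * y z = 0]. On the vectors involved the truncated
    inverse therefore acts as [1 - X y]. *)
Lemma act_formal_word s k m :
  (forall x, x \in y_arguments u s -> C (y x)) -> (k < m)%N ->
  act b (formal_word m p (map (letter_map polyC) s))`_k u = X s k.
Proof.
elim: s k => [|e s IH] k ys km.
  rewrite /= coef1; case: k km => [|k] _ /=; last by rewrite mulr0n act0.
  by rewrite mulr1n -polyC1 actC mul1r.
have ys' x : x \in y_arguments u s -> C (y x).
  by move=> xs; apply: ys; rewrite mem_cat xs orbT.
rewrite /= coefCM actM actC; congr (_ * _).
set G := (rco e)%:P%:P * _; pose Z j := rco e * X s j.
have GE j : (j < m)%N -> act b G`_j u = Z j.
  by move=> jm; rewrite coefCM actM actC IH.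
have yyZ j : y (y (Z j)) = 0.
  have yZ : C (y (Z j)).
    by apply: act_expansion_centralizes => // x xs; apply: ys; rewrite mem_cat map_f.
  by rewrite -[y (Z j)]mul1r act_vmul // p1 mul0r.
have mulE (H : {poly {poly D}}) j :
    act b ((1 + p%:P * 'X) * H)`_j u = act b H`_j u
      + (if j is j'.+1 then y (act b H`_j' u) else 0).
  rewrite mulrDl mul1r coefD act_add -mulrA -commr_polyX mulrA coefMX.
  by case: j => [|j]; rewrite ?act0 //= coefCM actM.
rewrite /expansion_step -/(Z k); case: (lpos e).
  by rewrite mulE GE //; case: k km => //= k km; rewrite GE // ltnW.
pose H := geometric m p * G.
have HE j : (j < m)%N -> act b H`_j u = Z j - (if j is j'.+1 then y (act b H`_j' u) else 0).
  move=> jm; rewrite -GE // -[G in RHS](addrK (((- p) ^+ m *: 'X^m) * G)).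
  have -> : G + (- p) ^+ m *: 'X^m * G - (- p) ^+ m *: 'X^m * G
     = (1 - (- p) ^+ m *: 'X^m) * G + (- p) ^+ m *: 'X^m * G.
    by rewrite mulrBl mul1r subrK addrK.
  rewrite -(proj1 (geometricE m p)) -mulrA -/H coefD act_add mulE -scalerAl coefZ.
  by rewrite coefXnM jm mulr0 act0 addr0 addrK.
(* The recursion is [H_k = Z_k - y H_(k-1)]; since [y] kills [y Z_j], [y H_(k-1)] reduces to
   [y Z_(k-1)]. *)
rewrite -/H; elim: k km => [|k IHk] km; first by rewrite HE ?subr0 ?addr0.
rewrite HE // IHk; last exact: ltnW.
case: k {IHk km} => [|k]; first by rewrite addr0.
by rewrite act_vsub yyZ subr0.
Qed.

End Action.

Lemma rank_one_no_word e w d (h : D) : ~ ring_center h -> lco e != 0 ->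
  rco (last e w) != 0 ->
  path_prop (fun e e' => ~ ring_center (rco e * lco e')) e w ->
  (forall x, x != 0 -> weval (fun=> x) (fun=> x^-1) (e :: w) = d) -> False.
Proof.
move=> nch l0 r0 wJ wd.
have [A [ncA hA wA]] := junction_list (P := fun a => ~ ring_center a) nch wJ.
have [b bA] := common_noncommuting ncA.
(* The last right coefficient times [u] is [h], an element of [A]. *)
pose u := (rco (last e w))^-1 * h.
have [p [p1 pt pA]] := act_generic divD infF (y_arguments u (e :: w) ++ A) bA.
have ys x : x \in y_arguments u (e :: w) -> act b p x * b = b * act b p x.
  by move=> xs; apply: pt; rewrite mem_cat xs.
pose K z := z * b = b * z /\ z != 0.
have yA a : a \in A -> K (act b p a).
  by move=> aA; split; [apply: pt; rewrite mem_cat aA orbT | apply: pA].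
have [||||||z [_ z0] E] := @expansion_top _ D (fun a v : D => a * v) (act b p) u _ _ _ K e w.
- by move=> a; rewrite mulr0.
- by move=> a c v; rewrite mulrA.
- exact: act_v0.
- by move=> v [vb v0]; split; [rewrite mulNr mulrN vb | rewrite oppr_eq0].
- apply: path_prop_impl wA => e1 e2 /yA[ab a0] v [vb v0]; rewrite act_vmul //.
  by split; [rewrite -mulrA vb mulrA ab mulrA | apply: div_mulf_neq0].
- by rewrite /u mulVKr ?divD //; apply: yA.
(* The top coefficient is nonzero by density, yet zero because the word is constant; [(size w).+2]
   is the least truncation that retains it. *)
move: (div_mulf_neq0 divD l0 z0); rewrite -E.
rewrite -(@act_formal_word b u p p1 (e :: w) _ (size w).+2) //.
by rewrite (@formal_word_coef_poly D divD infF p (e :: w) d) ?ltnSn // act0 eqxx.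
Qed.

Lemma noncentral_entry (a : 'M[D]_1) : noncentral a -> ~ ring_center (a 0 0).
Proof.
move=> [u _ au] ca; apply: au; apply/matrixP => i j.
by rewrite !ord1 !mxE !big_ord1.
Qed.

Lemma rank_one_no_strict_word (h : 'M[D]_1) : noncentral h ->
  has_word (@strict_junction D 1) (@inGL D 1) -> False.
Proof.
move=> nch.
have entM (a c : 'M[D]_1) : (a * c) 0 0 = a 0 0 * c 0 0 by rewrite mxE big_ord1.
have scal x : x != 0 -> inverses (x%:M : 'M[D]_1) (x^-1)%:M.
  by move=> /divD ux; split; rewrite -mulmxE -scalar_mxM ?divrr ?mulVr.
have ent_neq0 (a : 'M[D]_1) : inGL a -> a 0 0 != 0.
  move=> [c [ac _]]; apply/eqP => a0.
  have := congr1 (fun z : 'M[D]_1 => z 0 0) ac; rewrite entM a0 mul0r mxE => /eqP.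
  by rewrite eq_sym oner_eq0.
pose k := h 0 0; have nck : ~ ring_center k := noncentral_entry nch.
pose g (mu : D) := 1 + mu * k.
have [s0 Hs0] : exists s : seq D, forall mu, ring_center mu -> mu \notin s -> g mu != 0.
  have [|s Hs] := @central_roots_finite D divD (1 + k%:P * 'X).
    apply/eqP => /(congr1 (fun p : {poly D} => p`_0))/eqP.
    by rewrite coefD coef1 coefMX addr0 coef0 oner_eq0.
  exists s => mu cmu; apply: contra => /eqP g0; apply: Hs => //.
  by rewrite hornerD hornerC hornerMX hornerC -cmu.
have g_nc (mu nu : D) : ring_center mu -> mu \notin s0 -> ring_center nu ->
    nu \notin s0 -> mu != nu -> noncentral (((g mu)^-1)%:M * (g nu)%:M : 'M[D]_1).
  move=> cmu mus cnu nus munu; apply: NNPP => /not_noncentral cen.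
  have gmu0 := Hs0 mu cmu mus; have gnu0 := Hs0 nu cnu nus.
  (* If [z] is central, [(nu - mu z) k = z - 1] makes [k] central unless [nu = mu z]; in that case
     [z = 1] and [nu = mu]. *)
  pose z := (g mu)^-1 * g nu.
  have cz : ring_center z.
    move=> x; have [->|x0] := eqVneq x 0; first by rewrite mul0r mulr0.
    have [Gx _] := inverses_inGL (scal x x0).
    have := congr1 (fun z : 'M[D]_1 => z 0 0) (cen _ Gx).
    by rewrite !entM !mxE !eqxx !mulr1n.
  have gz : g nu = g mu * z by rewrite /z mulVKr // divD.
  have E : (nu - mu * z) * k = z - 1.
    move: gz; rewrite /g mulrDl mul1r -mulrA -(cz k) mulrA => gz.
    by rewrite mulrBl -[nu * k](addKr 1) gz addrA addrK addrC.
  have cnumu : ring_center (nu - mu * z).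
    by apply: centerB => // x; rewrite -mulrA (cz x) mulrA (cmu x) -mulrA.
  have [t0|t0] := eqVneq (nu - mu * z) 0.
    move: E; rewrite t0 mul0r => /esym/eqP; rewrite subr_eq0 => /eqP z1.
    by move/eqP: t0; rewrite z1 mulr1 subr_eq0 eq_sym (negbTE munu).
  apply: nck => x; apply: (mulrI (divD t0)).
  rewrite mulrA E mulrA cnumu -mulrA E mulrBl mulrBr cz.
  by rewrite mul1r mulr1.
move=> /(@single_variable_word D 1 infF (fun mu => (g mu)%:M)
  (fun mu => ((g mu)^-1)%:M) s0) [].
- by move=> mu cmu mus; apply/scal/Hs0.
- exact: g_nc.
move=> e [w [d [winv wJ wd]]].
pose f := letter_map (fun a : 'M[D]_1 => a 0 0).
apply: (@rank_one_no_word (f e) (map f w) (d 0 0) k nck).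
- by apply: ent_neq0; case: winv => -[].
- by rewrite last_map; apply: ent_neq0; have [] := all_prop_last winv.
- elim: w e wJ {winv wd} => [//|e' w IH] e /= [/noncentral_entry J wJ].
  by split; [rewrite -entM | apply: IH].
move=> x x0; rewrite -(wd _ _ (scal x x0)) -[f e :: _]/(map f (e :: w)).
elim: (e :: w) => [|e' w' IH]; first by rewrite /= mxE.
rewrite [weval _ _ (_ :: _)]/= IH [in RHS]/= entM /leval !entM.
by rewrite /=; case: (lpos e'); rewrite mxE mulr1n.
Qed.

End RankOne.

(** * Almost subnormal subgroups with a generalized identity *)

Theorem theorem2p2 (D : unitRingType) (n : nat) :
  is_division_ring D ->
  infinite_set (@ring_center D) ->
  (0 < n)%N ->
  forall G : 'M[D]_n -> Prop,
    is_subgroup G ->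
    almost_subnormal G (@inGL D n) ->
    (exists w : ggmonomial D n, is_gen_monomial w /\ satisfies_ggi G w) ->
    forall A, G A -> central_GL A.
Proof.
move=> divD infF n_gt0 G sG asG [w [wgen wG]] A GA; apply: NNPP => ncA.
have {}ncA : noncentral A by apply: noncentralP => //; case: sG => /(_ A GA).
have := has_word_GL sG asG GA ncA (has_word_of_ggi wgen wG).
case: n n_gt0 G sG asG w wgen wG A GA ncA => [//|[|n]] _ G _ _ w _ _ A _ ncA.
  exact: rank_one_no_strict_word ncA.
exact: rank_ge2_no_word.
Qed.
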